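(* Let $p\in\mathbb{N}$, $p\ge 2$. Then for each $z\in B_{\ell_p}$, the fiber $\mathcal{M}_z$ in $\mathcal{M}(\mathcal{A}_u(B_{\ell_p}))$ contains a set of cardinality $2^{\mathfrak{c}}$ such that any two distinct elements of this set belong to different Gleason parts.
   Context: Here $\ell_p$ is the complex Banach space of $p$-summable complex sequences, $B_{\ell_p}$ its open unit ball, and $\mathfrak{c}$ the cardinality of the continuum. $\mathcal{A}_u(B_{\ell_p})$ is the complex Banach algebra of all holomorphic functions $f\colon B_{\ell_p}\to\mathbb{C}$ that are uniformly continuous with respect to the norm of $\ell_p$, with the norm $\|f\|=\sup\{|f(x)|:\|x\|<1\}$. The spectrum $\mathcal{M}(\mathcal{A})$ of a commutative complex Banach algebra $\mathcal{A}$ with identity is the set of all nonzero algebra homomorphisms $\varphi\colon\mathcal{A}\to\mathbb{C}$. The (restrictions to $B_{\ell_p}$ of the) functionals of the dual space $\ell_p'$ belong to $\mathcal{A}_u(B_{\ell_p})$, and since $\ell_p$ is reflexive for $1<p<\infty$, each restriction $\varphi|_{\ell_p'}$, $\varphi\in\mathcal{M}(\mathcal{A}_u(B_{\ell_p}))$, is identified with a point of the closed unit ball $\overline{B}_{\ell_p}$. The fiber over $z\in\overline{B}_{\ell_p}$ is $\mathcal{M}_z=\{\varphi\in\mathcal{M}(\mathcal{A}_u(B_{\ell_p})):\varphi(x')=x'(z)\text{ for all }x'\in\ell_p'\}$. For $\varphi,\psi\in\mathcal{M}(\mathcal{A})$ put $\|\varphi-\psi\|=\sup\{|\varphi(f)-\psi(f)|: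 f\in\mathcal{A},\ \|f\|\le 1\}$. The relation $\|\varphi-\psi\|<2$ is an equivalence relation on $\mathcal{M}(\mathcal{A})$; its equivalence classes are the Gleason parts, and the Gleason part of $\varphi$ is $\mathcal{GP}(\varphi)=\{\psi\in\mathcal{M}(\mathcal{A}):\|\varphi-\psi\|<2\}$. *)

(* Defs.v *)
From HB Require Import structures.
From mathcomp Require Import all_boot all_order all_algebra.
From mathcomp Require Import complex.
From mathcomp Require Import all_classical all_reals all_analysis.

Set Implicit Arguments.
Unset Strict Implicit.
Unset Printing Implicit Defensive.

Import Order.TTheory GRing.Theory Num.Theory.
Import numFieldNormedType.Exports.
Import ComplexField.Normc.

Local Open Scope classical_set_scope.
Local Open Scope ring_scope.
Local Open Scope complex_scope.

(* Throughout, the scalar field is [(R[i])^o], the complex numbers seen as a   *)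
(* normed module over themselves; norms in a [normedModType R[i]] take their  *)
(* values in [R[i]], while [normc] is the [R]-valued complex modulus.          *)

Section lp_norm.
Context {R : realType}.
Local Notation C := (R[i])^o.
Implicit Types (p : nat) (x y : nat -> R[i]).

Definition lp_norm p x : \bar R := Lnorm counting p%:R%:E (fun n => (normc (x n))%:E).

Lemma normc_ge0 (c : R[i]) : 0 <= normc c.
Proof. by case: c => a b; exact: sqrtr_ge0. Qed.

Lemma lp_normE p x : (1 <= p)%N ->
  lp_norm p x = ((\sum_(0 <= n <oo) (normc (x n) ^+ p)%:E) `^ (p%:R)^-1)%E.
Proof.
move=> p1; rewrite /lp_norm Lnorm_counting ?ltr0n//; congr (_ `^ _)%E.
apply: eq_eseriesr => n _ /=.
by rewrite ger0_norm ?normc_ge0// powR_mulrn// normc_ge0.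
Qed.

Lemma lp_norm_ge0 p x : (0 <= lp_norm p x)%E.
Proof. exact: Lnorm_ge0. Qed.

Lemma lp_normD p x y : (1 <= p)%N ->
  (lp_norm p (x + y)%R <= lp_norm p x + lp_norm p y)%E.
Proof.
move=> p1.
have := @eminkowski _ _ R counting ((@normc R \o x) : nat -> R)
  (@normc R \o y) p%:R%:E.
rewrite lee_fin ler1n => /(_ _ _ p1); set N := Lnorm _ _ _ => H.
apply: (@le_trans _ _ N); last by apply: H.
rewrite lp_normE// /N Lnorm_counting ?ltr0n//.
apply: gt0_ler_poweR; rewrite ?invr_ge0//.
- by rewrite in_itv/= leey andbT nneseries_ge0// => n _ _; rewrite lee_fin exprn_ge0// normc_ge0.
- by rewrite in_itv/= leey andbT nneseries_ge0// => n _ _; rewrite poweR_ge0.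
apply: lee_nneseries => n _.
  by rewrite lee_fin exprn_ge0// normc_ge0.
rewrite /= ger0_norm ?addr_ge0 ?normc_ge0//.
rewrite powR_mulrn ?addr_ge0 ?normc_ge0// lee_fin lerXn2r ?nnegrE ?addr_ge0 ?normc_ge0//.
exact: le_normcD.
Qed.

Lemma lp_normZ p (c : R[i]) x : (1 <= p)%N ->
  lp_norm p (c *: (x : nat -> C))%R = ((normc c)%:E * lp_norm p x)%E.
Proof.
move=> p1; rewrite !lp_normE//.
under eq_eseriesr do rewrite normcM exprMn EFinM.
rewrite nneseriesZl; last by move=> n _; rewrite lee_fin exprn_ge0// normc_ge0.
rewrite poweRM ?lee_fin ?exprn_ge0 ?normc_ge0//; last first.
  by rewrite nneseries_ge0// => n _ _; rewrite lee_fin exprn_ge0// normc_ge0.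
congr (_ * _)%E.
by rewrite poweR_EFin -powR_mulrn ?normc_ge0// -powRrM mulfV ?powRr1 ?normc_ge0// pnatr_eq0 -lt0n.
Qed.

Lemma lp_norm0 p : (1 <= p)%N -> lp_norm p (0 : nat -> R[i]) = 0%E.
Proof.
move=> p1; rewrite lp_normE// eseries0 ?poweR0r ?invr_eq0 ?pnatr_eq0 -?lt0n// => n _ _.
by rewrite normc0 expr0n; case: p p1.
Qed.

Lemma lp_norm_eq0 p x : (1 <= p)%N -> lp_norm p x = 0%E -> x = 0.
Proof.
move=> p1; have t0 n : (0 <= (normc (x n) ^+ p)%:E)%E.
  by rewrite lee_fin exprn_ge0// normc_ge0.
rewrite lp_normE// => /poweR_eq0_eq0 xp0; apply/funext => n.
have {}xp0 := xp0 (nneseries_ge0 (fun n _ _ => t0 n)).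
have xn0 : ((normc (x n) ^+ p)%:E <= 0)%E.
  rewrite -[leRHS]xp0 (@nneseriesD1 _ _ n)// leeDl//.
  exact: nneseries_ge0.
apply: eq0_normc; apply/eqP; move: xn0; rewrite lee_fin => xn0.
have : normc (x n) ^+ p == 0 by rewrite eq_le xn0 exprn_ge0// normc_ge0.
by rewrite expf_eq0 => /andP[].
Qed.

End lp_norm.

Section lp_space.
Context {R : realType} {p : nat}.
Local Notation C := (R[i])^o.

Definition lp_summable : {pred nat -> C} := mem [set x | (lp_norm p x < +oo)%E].

(* [p1] is a phantom argument: it is what makes the norm below canonical. *)
Record lp (p1 : (1 <= p)%N) := Lp { lp_val :> nat -> C ; _ : lp_val \in lp_summable }.

Context (p1 : (1 <= p)%N).
Local Notation lpT := (lp p1).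

Fact lp_submod_closed : submod_closed lp_summable.
Proof.
split; first by rewrite inE /= lp_norm0.
move=> c x y; rewrite !inE/= => xoo yoo.
rewrite (le_lt_trans (lp_normD _ _ p1))// lte_add_pinfty// lp_normZ//.
by rewrite lte_mul_pinfty// lee_fin normc_ge0.
Qed.

#[local] HB.instance Definition _ :=
  GRing.isSubmodClosed.Build _ _ lp_summable lp_submod_closed.
HB.instance Definition _ := [isSub of lpT for @lp_val p1].
HB.instance Definition _ := [Choice of lpT by <:].
HB.instance Definition _ := [SubChoice_isSubLmodule of lpT by <:].

Definition lp_fnorm (x : lpT) : R[i] := (fine (lp_norm p x))%:C.

Fact lp_fin_num (x : lpT) : lp_norm p x \is a fin_num.
Proof.
by have := valP x; rewrite inE/= ge0_fin_numE ?lp_norm_ge0.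
Qed.

Fact lp_fnormD (x y : lpT) : lp_fnorm (x + y) <= lp_fnorm x + lp_fnorm y.
Proof.
rewrite /lp_fnorm -rmorphD/= lecR -fineD ?lp_fin_num//.
apply: fine_le; last exact: lp_normD.
  exact: (lp_fin_num (x + y)).
by rewrite fin_numD !lp_fin_num.
Qed.

Fact lp_fnormZ (c : R[i]) (x : lpT) : lp_fnorm (c *: x) = `|c| * lp_fnorm x.
Proof.
have cx : lp_norm p (c *: x) = ((normc c)%:E * lp_norm p x)%E by exact: lp_normZ.
rewrite /lp_fnorm cx.
by rewrite fineM ?lp_fin_num// rmorphM.
Qed.

Fact lp_fnorm_eq0 (x : lpT) : lp_fnorm x = 0 -> x = 0.
Proof.
move=> [] x0; apply/val_inj/(lp_norm_eq0 p1).
by rewrite -[LHS]fineK ?lp_fin_num// x0.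
Qed.

HB.instance Definition _ :=
  Lmodule_isNormed.Build R[i] lpT lp_fnormD lp_fnormZ lp_fnorm_eq0.

Lemma lp_normrE (x : lpT) : `|x| = (fine (lp_norm p x))%:C.
Proof. by []. Qed.

End lp_space.
Arguments lp R {p} p1.

Fact near_eq_differentiable (K : numFieldType) (V W : normedModType K)
    (f g : V -> W) (x : V) :
  {near x, f =1 g} -> differentiable f x -> differentiable g x.
Proof.
move=> fg df; have fgx : f x = g x := nbhs_singleton fg.
have dg : g \o shift x = cst (g x) + 'd f x +o_ 0 id.
  apply/eqaddoP => e e0; have /eqaddoP/(_ e e0) := diff_locally df.
  have {}fg : \forall y \near 0, f (y + x) = g (y + x).
    by move: fg; rewrite [X in X -> _](near_shift 0 x) subr0.
  by apply: filterS2 fg => y /= fgy; rewrite !fctE /= fgy fgx.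
have dgE := diff_unique (diff_continuous df) dg.
by apply/diff_locallyP; rewrite dgE; split => //; exact: diff_continuous.
Qed.

Fact posC_min (R : rcfType) (a b : R[i]) : 0 < a -> 0 < b ->
  exists2 m : R[i], 0 < m & m <= a /\ m <= b.
Proof.
move=> a0 b0; have /orP[ab|ba] := real_leVge (gtr0_real a0) (gtr0_real b0).
  by exists a.
by exists b.
Qed.

Section Au_pred.
Context {R : realType} (V : normedModType R[i]).
Local Notation C := (R[i])^o.

Definition unit_ball : set V := ball 0 1.

(* Complex Frechet differentiability: since the scalars are [R[i]], the        *)
(* differential is [R[i]]-linear (and continuous). The extension of [f] by 0   *)
(* outside the ball plays no role, the ball being open.                        *)
Definition holomorphic_on_ball (f : unit_ball -> C) :=
  forall x, unit_ball x -> differentiable ('valL_0 f) x.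

(* [unif_continuous] refers to the uniform structure that the subtype          *)
(* [unit_ball] inherits from [V]; see [unif_continuous_ballP].                 *)
Definition Au_pred : {pred unit_ball -> C} :=
  mem [set f | holomorphic_on_ball f /\ unif_continuous f].

Record Au := MkAu { Au_fun :> unit_ball -> C ; _ : Au_fun \in Au_pred }.

Lemma unif_continuous_ballP (f : unit_ball -> C) :
  unif_continuous f <->
  forall e : R[i], 0 < e -> exists2 d : R[i], 0 < d &
    forall x y : unit_ball, `|val x - val y| < d -> `|f x - f y| < e.
Proof.
split=> [fu e e0|fu A].
  have /fu : entourage [set xy : C * C | ball xy.1 e xy.2].
    exact: (@entourage_ball _ _ (PosNum e0)).
  rewrite nbhs_simpl/= => -[B]; rewrite -entourage_ballE => -[d d0 dB BA].
  exists d => // x y xy.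
  have := BA (x, y); apply; apply: dB => /=.
  by rewrite -ball_normE.
rewrite -entourage_ballE => -[e e0 eA]; have [d d0 df] := fu _ e0.
rewrite nbhs_simpl/=; exists [set xy | ball xy.1 d xy.2].
  exact: (@entourage_ball _ _ (PosNum d0)).
move=> [x y] /=; rewrite -ball_normE => /df fxy.
by apply: eA; rewrite /= -ball_normE.
Qed.

Lemma unit_ballE (x : V) : unit_ball x = (`|x| < 1) :> Prop.
Proof. by rewrite /unit_ball -ball_normE /= sub0r normrN. Qed.

Lemma valL_in (f : unit_ball -> C) (x : unit_ball) :
  'valL_0 f (val x) = f x.
Proof. by have /(congr1 (@^~ x)) := valLK 0 f. Qed.

Fact unif_continuous_bounded (f : unit_ball -> C) :
  unif_continuous f -> exists2 M : R[i], 0 < M & forall x, `|f x| < M.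
Proof.
move=> /unif_continuous_ballP /(_ 1 ltr01) [d d0 fd].
have B0 : unit_ball 0 by rewrite unit_ballE normr0.
pose o : unit_ball := SigSub (mem_set B0).
have fn n (x : unit_ball) : `|val x| < n.+1%:R * d -> `|f x| < `|f o| + n.+1%:R.
  elim: n x => [|n ih] x xd.
    rewrite -[f x](subrK (f o)) (le_lt_trans (ler_normD _ _))// addrC ltrD2l.
    by rewrite fd//= subr0; rewrite mul1r in xd.
  have n2 : 0 < n.+2%:R :> R[i] by rewrite ltr0n.
  pose y := (n.+1%:R / n.+2%:R : R[i]) *: val x.
  have yE : `|y| = n.+1%:R / n.+2%:R * `|val x|.
    by rewrite normrZ ger0_norm ?divr_ge0.
  have yB : unit_ball y.
    rewrite unit_ballE yE; have := set_valP x; rewrite unit_ballE => x1.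
    rewrite (le_lt_trans _ x1)// ler_piMl//.
    by rewrite ler_pdivrMr// mul1r ler_nat.
  pose y' : unit_ball := SigSub (mem_set yB).
  have xy : val x - y = n.+2%:R^-1 *: val x.
    rewrite /y -[X in X - _]scale1r -scalerBl; congr (_ *: _).
    by rewrite -[X in X - _](@divff _ n.+2%:R) ?gt_eqF// -mulrBl -natrB// subSnn mul1r.
  have := ih y'; rewrite /= yE.
  have -> : n.+1%:R / n.+2%:R * `|val x| < n.+1%:R * d.
    by rewrite -mulrA ltr_pM2l ?ltr0n// mulrC ltr_pdivrMr// mulrC.
  move=> /(_ isT) fy.
  rewrite -[f x](subrK (f y')) (le_lt_trans (ler_normD _ _))//.
  rewrite -[n.+2]add1n natrD addrCA ltrD// fd//= xy normrZ ger0_norm ?invr_ge0//.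
  by rewrite mulrC ltr_pdivrMr// mulrC.
have [n nd] : exists n : nat, 1 < n.+1%:R * d.
  have dR : d = (complex.Re d)%:C by rewrite RRe_real// gtr0_real.
  have d0' : 0 < complex.Re d by move: d0; rewrite dR ltcR.
  exists (Num.truncn (complex.Re d)^-1).
  rewrite dR -[_%:R](rmorph_nat (real_complex R)) -rmorphM/= -[1]/(1%:C) ltcR.
  have i0 : 0 <= (complex.Re d)^-1 by rewrite invr_ge0 ltW.
  by rewrite -ltr_pdivrMr// mul1r; have /andP[] := truncn_itv i0.
exists (`|f o| + n.+1%:R) => [|x]; first by rewrite ltr_wpDl.
apply: fn; apply: lt_trans nd.
by have := set_valP x; rewrite unit_ballE.
Qed.

Fact holomorphic_sigL (g : V -> C) :
  (forall x, unit_ball x -> differentiable g x) ->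
  holomorphic_on_ball (sigL unit_ball g).
Proof.
move=> dg x Bx; apply: near_eq_differentiable (dg _ Bx).
have : nbhs x unit_ball.
  by apply: open_nbhs_nbhs; split=> //; exact: ball_open.
by apply: filterS => y By; rewrite -[y]/(val (SigSub (mem_set By) : unit_ball)) valL_in.
Qed.

Fact Au_pred1 : (1 : unit_ball -> C) \in Au_pred.
Proof.
rewrite inE; split; first by apply: (@holomorphic_sigL (cst 1)) => x _; exact: differentiable_cst.
by apply/unif_continuous_ballP => e e0; exists 1 => // x y _; rewrite subrr normr0.
Qed.

Fact Au_linear_closed : GRing.linear_closed Au_pred.
Proof.
move=> c f g; rewrite !inE => -[df uf] [dg ug]; split.
  have -> : c *: f + g = sigL unit_ball (c *: 'valL_0 f + 'valL_0 g).
    by apply/funext => x; rewrite /sigL/= !fctE !valL_in.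
  apply: holomorphic_sigL => x Bx.
  by apply: differentiableD; [apply: differentiableZ; exact: df|exact: dg].
apply/unif_continuous_ballP => e e0.
have c0 : 0 < `|c| + 1 by rewrite ltr_wpDl.
have [|d d0 fd] := (unif_continuous_ballP f).1 uf (e / 2 / (`|c| + 1)).
  by rewrite !divr_gt0.
have [|d' d'0 gd] := (unif_continuous_ballP g).1 ug (e / 2).
  by rewrite !divr_gt0.
have [m m0 [md md']] := posC_min d0 d'0; exists m => // x y xy.
have {md}xd := lt_le_trans xy md; have {xy md'}xd' := lt_le_trans xy md'.
rewrite !fctE opprD addrACA -scalerBr (le_lt_trans (ler_normD _ _))//.
rewrite [e]splitr ltr_leD// ?ltW ?gd//.
rewrite normrZ (@le_lt_trans _ _ ((`|c| + 1) * `|f x - f y|))//.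
  by rewrite ler_wpM2r// lerDl.
by rewrite mulrC -ltr_pdivlMr// fd.
Qed.

Fact Au_mulr_closed : GRing.mulr_2closed Au_pred.
Proof.
move=> f g; rewrite !inE => -[df uf] [dg ug]; split.
  have -> : f * g = sigL unit_ball ('valL_0 f * 'valL_0 g).
    by apply/funext => x; rewrite /sigL/= !fctE !valL_in.
  apply: holomorphic_sigL => x Bx.
  by apply: differentiableM; [exact: df|exact: dg].
have [M M0 fM] := unif_continuous_bounded uf.
have [N N0 gN] := unif_continuous_bounded ug.
apply/unif_continuous_ballP => e e0.
have [|d d0 fd] := (unif_continuous_ballP f).1 uf (e / 2 / N).
  by rewrite !divr_gt0.
have [|d' d'0 gd] := (unif_continuous_ballP g).1 ug (e / 2 / M).
  by rewrite !divr_gt0.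
have [m m0 [md md']] := posC_min d0 d'0; exists m => // x y xy.
have {md}xd := lt_le_trans xy md; have {xy md'}xd' := lt_le_trans xy md'.
rewrite !fctE.
have -> : f x * g x - f y * g y = f x * (g x - g y) + (f x - f y) * g y.
  by rewrite mulrBr mulrBl addrA subrK.
rewrite (le_lt_trans (ler_normD _ _))// !normrM [e]splitr ltrD//.
  apply: (@le_lt_trans _ _ (M * `|g x - g y|)).
    by rewrite ler_wpM2r// ltW.
  by rewrite mulrC -ltr_pdivlMr// gd.
apply: (@le_lt_trans _ _ (`|f x - f y| * N)).
  by rewrite ler_wpM2l// ltW.
by rewrite -ltr_pdivlMr// fd.
Qed.

Fact Au_subring_closed : GRing.subring_closed Au_pred.
Proof.
split; first exact: Au_pred1.
  by move=> f g fA gA; rewrite -[f - g]addrC -scaleN1r; exact: Au_linear_closed.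
exact: Au_mulr_closed.
Qed.

Fact Au_submod_closed : GRing.submod_closed Au_pred.
Proof.
split; last exact: Au_linear_closed.
by rewrite -(subrr 1); case: Au_subring_closed => A1 AB _; exact: AB.
Qed.

#[local] HB.instance Definition _ :=
  GRing.isSubringClosed.Build _ Au_pred Au_subring_closed.
#[local] HB.instance Definition _ :=
  GRing.isSubmodClosed.Build _ _ Au_pred Au_submod_closed.
HB.instance Definition _ := [isSub for Au_fun].
HB.instance Definition _ := [Choice of Au by <:].
HB.instance Definition _ := GRing.SubChoice_isSubComPzRing.Build _ _ Au Au_subring_closed.
HB.instance Definition _ := [SubZmodule_isSubLmodule of Au by <:].

Fact Au_oner_neq0 : 1 != 0 :> Au.
Proof.
have B0 : unit_ball 0 by rewrite unit_ballE normr0.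
apply/eqP => /(congr1 val)/(congr1 (@^~ (SigSub (mem_set B0)))) /eqP.
by rewrite oner_eq0.
Qed.
HB.instance Definition _ := GRing.PzSemiRing_isNonZero.Build Au Au_oner_neq0.

Fact Au_scalerAl (c : R[i]) (f g : Au) : c *: (f * g) = (c *: f) * g.
Proof. by apply/val_inj/funext => x; exact: mulrA. Qed.
HB.instance Definition _ := GRing.LSemiModule_isLSemiAlgebra.Build _ Au Au_scalerAl.

Fact Au_scalerAr (c : R[i]) (f g : Au) : c *: (f * g) = f * (c *: g).
Proof. by apply/val_inj/funext => x; exact: mulrCA. Qed.
HB.instance Definition _ := GRing.LSemiAlgebra_isSemiAlgebra.Build _ Au Au_scalerAr.

Lemma dual_Au_subproof (l : {linear V -> C}) :
  continuous l -> sigL unit_ball l \in Au_pred.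
Proof.
move=> cl; rewrite inE; split.
  by apply: holomorphic_sigL => x _; exact: linear_differentiable.
have [M M0 lM] : exists2 M : R[i], 0 < M & forall x, `|l x| <= M * `|x|.
  have /linear_boundedP/pinfty_ex_gt0[M M0 lM] := continuous_linear_bounded 0 (cl 0).
  by exists M.
apply/unif_continuous_ballP => e e0; exists (e / M); first by rewrite divr_gt0.
move=> x y xy; rewrite /sigL/= -linearB (le_lt_trans (lM _))//.
by rewrite mulrC -ltr_pdivlMr.
Qed.

(* The restriction to the ball of a functional in the dual of [V]. *)
Definition dual_Au (l : {linear V -> C}) (cl : continuous l) : Au :=
  MkAu (dual_Au_subproof cl).

(* Suprema are taken in [\bar R], so no boundedness side condition is needed. *)
Definition sup_norm (f : Au) : \bar R :=
  ereal_sup (range (fun x => (normc (f x))%:E)).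

Definition spectrum : set (Au -> C) :=
  [set phi | [/\ linear phi, {morph phi : f g / f * g} & phi <> 0]].

Definition fiber (z : V) : set (Au -> C) :=
  [set phi | spectrum phi /\
    forall (l : {linear V -> C}) (cl : continuous l), phi (dual_Au cl) = l z].

Definition spectrum_dist (phi psi : Au -> C) : \bar R :=
  ereal_sup [set (normc (phi f - psi f))%:E | f in [set f | (sup_norm f <= 1)%E]].

Definition gleason_part (phi : Au -> C) : set (Au -> C) :=
  [set psi | spectrum psi /\ (spectrum_dist phi psi < 2%:E)%E].

End Au_pred.

(* Main.v *)
From HB Require Import structures.
Require Import Defs.
From mathcomp Require Import all_boot all_order all_algebra.
From mathcomp Require Import complex.
From mathcomp Require Import all_classical all_reals all_analysis.
From mathcomp Require Import ring lra zify.
Import Order.TTheory GRing.Theory Num.Theory.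
Import numFieldNormedType.Exports.
Import ComplexField.Normc.

(** Let [r] be the number with [r ^ p = 1 - |z| ^ p] and replace the [n]-th
    coordinate of [z] by [t_n * r], where [t_n < 1] tends to [1].  The points
    [y_n] obtained in this way lie in the open ball, their norms tend to [1],
    and they converge weakly to [z] because the unit vectors are weakly null.
    For a free ultrafilter [U] on [nat], [f |-> lim_U f (y_n)] is therefore a
    homomorphism in the fiber over [z] ([fiber_hom_fiber]).

    These homomorphisms are told apart by the diagonal polynomials
    [P_b x = \sum_k b_k x_k ^ p], which belong to the algebra because [p] is
    an integer ([diag_Au]).  If [b] takes the value [1] on a member of
    [U] and [-1] on a member of [W], then [P_b] takes the values
    [P_b z + r ^ p] at [U] and [P_b z - r ^ p] at [W] ([fiber_hom_diag]): they
    differ by [2 * r ^ p].  This is already [2] when [z = 0].  In general the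
    defect [r ^ p < 1] has to be compensated by a factor that is large near
    [z].  Take [b] supported on the coordinates [k >= N], put
    [h = \sum_(k < N) |z_k| ^ p], and let [L] be the multiple with
    [L z = h] of the norming functional of the first [N] coordinates of [z].  With [c = p / ((1 - h) * m)] and [m] large, the
    function [(1 + c * (L - h)) ^ m * P_b / (1 - h)] is bounded by [1] on the
    ball ([sup_norm_separator]): by the inequality between the arithmetic and
    the geometric mean, this reduces to the tangent line inequality
    [p * u ^ (p - 1) * (v - u) <= v ^ p - u ^ p], summed over the
    coordinates.  Since [L] takes the value [h] on the whole fiber, the first
    factor becomes [1] there, and the two values differ by
    [2 * r ^ p / (1 - h)], which tends to [2] with [N].  Hence the distance of
    the two homomorphisms is at least [2].

    It remains to provide enough ultrafilters.  An independent family of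
    subsets of [nat] indexed by the reals gives, for each set [X] of reals, a
    free ultrafilter that contains the [r]-th member of the family or its
    complement according to whether [r] is in [X] ([ultraP]).  Distinct sets
    [X] give homomorphisms at distance at least [2], so that [X] is
    recovered from its homomorphism. *)

Set Implicit Arguments.
Unset Strict Implicit.
Unset Printing Implicit Defensive.
Local Open Scope classical_set_scope.
Local Open Scope ring_scope.
Local Open Scope complex_scope.

(** * Ultrafilters separated by an independent family *)

Section independent_family.
Context {R : realType}.

Definition decode (n : nat) : nat * seq int := odflt (0%N, [::]) (unpickle n).

(** A natural number codes a scale [m] and a finite set of integers; [indep r]
    holds when the index of the cell of mesh [1 / m] around [r] is in this set.
    Finitely many reals lie in distinct cells at every fine scale, so that the
    sets [indep r], [r : R], form an independent family. *)
Definition indep (r : R) (n : nat) : bool :=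
  Num.floor ((decode n).1%:R * r) \in (decode n).2.

Lemma floor_neq (m : nat) (r s : R) :
  1 <= m%:R * `|r - s| -> Num.floor (m%:R * r) != Num.floor (m%:R * s).
Proof.
move=> mrs; apply/eqP => fE; move: mrs; apply/negP; rewrite -ltNge.
rewrite -[X in X * _]ger0_norm// -normrM mulrBr ltr_norml.
have /andP[r1 r2] := floor_itv (m%:R * r).
have /andP[s1 s2] := floor_itv (m%:R * s).
rewrite fE in r1 r2; move: r2 s2; rewrite intrD => r2 s2.
by apply/andP; split; lra.
Qed.

(** The bound [N] can be met because only finitely many scales are coded below
    [N]: it suffices to take [m] larger than all of them. *)
Lemma indep_exists (X : set R) (rs : seq R) (N : nat) :
  exists2 n, (N <= n)%N & {in rs, forall r, indep r n = (r \in X)}.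
Proof.
pose K := (\max_(n < N) (decode n).1)%N.
pose sep := [seq Num.truncn `|r - s|^-1 | r <- rs, s <- rs].
pose m := (maxn K (\max_(i <- sep) i)).+1.
pose B := [seq Num.floor (m%:R * r) | r <- rs & r \in X].
exists (pickle (m, B)).
  rewrite leqNgt; apply/negP => nN.
  have : ((decode (pickle (m, B))).1 <= K)%N.
    exact: (@leq_bigmax _ (fun i : 'I_N => (decode i).1) (Ordinal nN)).
  by rewrite /decode pickleK /= leqNgt ltnS leq_maxl.
move=> r rrs; rewrite /indep /decode pickleK /=.
have [rX|rX] := boolP (r \in X).
  by apply/mapP; exists r; rewrite // mem_filter rX.
apply/negbTE/negP => /mapP[s]; rewrite mem_filter => /andP[sX srs] /eqP.
apply/negP/floor_neq.
have rs0 : 0 < `|r - s|.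
  by rewrite normr_gt0 subr_eq0; apply/eqP => rsE; rewrite rsE sX in rX.
rewrite -ler_pdivrMr// div1r.
have : (Num.truncn (`|r - s|^-1)%R < m)%N.
  rewrite ltnS leq_max; apply/orP; right.
  apply: (@leq_bigmax_seq _ _ xpredT id) => //.
  by apply: (allpairs_f (fun r s => Num.truncn `|r - s|^-1)).
rewrite -(@ler_nat R) => /(le_trans _); apply; apply/ltW.
by have /andP[] := truncn_itv (ltW (etrans (invr_gt0 _) rs0)).
Qed.

Lemma ultra_family (X : set R) : exists U : set_system nat,
  [/\ UltraFilter U, \oo `<=` U & forall r, \forall n \near U, indep r n = (r \in X)].
Proof.
pose D (i : seq R * nat) :=
  [set n | (i.2 <= n)%N /\ {in i.1, forall r, indep r n = (r \in X)}].
have FF : ProperFilter (filter_from setT D).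
  apply: filter_from_proper; last first.
    by move=> [rs N] _; have [n Nn rsn] := indep_exists X rs N; exists n.
  apply: filter_from_filter; first by exists ([::], 0%N).
  move=> [rs N] [rs' N'] _ _; exists (rs ++ rs', maxn N N') => //.
  move=> n [/=]; rewrite geq_max => /andP[Nn N'n] H; split; split => //= r ri;
    by apply: H; rewrite mem_cat ri ?orbT.
have [U [UU FU]] := ultraFilterLemma FF; exists U; split => //.
  move=> P [N _ NP]; apply: FU; exists ([::], N) => // n [/= Nn _]; exact: NP.
move=> r; apply: FU; exists ([:: r], 0%N) => // n [_ /= H].
by apply: H; rewrite mem_head.
Qed.

Definition ultra (X : set R) : set_system nat := projT1 (cid (ultra_family X)).

Lemma ultraP X : [/\ UltraFilter (ultra X), \oo `<=` ultra X &
  forall r, \forall n \near ultra X, indep r n = (r \in X)].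
Proof. exact: projT2 (cid (ultra_family X)). Qed.

End independent_family.

(** * Limits and series of complex numbers *)

Section complex_limits.
Context {R : realType}.
Local Notation C := (R[i])^o.

Lemma Re_le_normc (x : R[i]) : `|complex.Re x| <= normc x.
Proof. by case: x => a b /=; rewrite -sqrtr_sqr ler_wsqrtr// lerDl sqr_ge0. Qed.

Lemma Im_le_normc (x : R[i]) : `|complex.Im x| <= normc x.
Proof. by case: x => a b /=; rewrite -sqrtr_sqr ler_wsqrtr// lerDr sqr_ge0. Qed.

Lemma normc_le_ReIm (x : R[i]) : normc x <= `|complex.Re x| + `|complex.Im x|.
Proof.
case: x => a b /=.
have -> : `|a| + `|b| = Num.sqrt ((`|a| + `|b|) ^+ 2) :> R.
  by rewrite sqrtr_sqr [RHS]ger0_norm// addr_ge0.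
rewrite ler_wsqrtr// sqrrD !real_normK ?num_real//.
by rewrite -addrA lerD2l lerDr mulrn_wge0// mulr_ge0.
Qed.

Lemma cvg_complex T (F : set_system T) (FF : Filter F) (g : T -> C) (a b : R) :
  (fun t => complex.Re (g t)) @ F --> a -> (fun t => complex.Im (g t)) @ F --> b ->
  g @ F --> (a +i* b : C).
Proof.
move=> /cvgrPdist_lt ga /cvgrPdist_lt gb; apply/cvgrPdist_lt => e e0.
have eE : e = (complex.Re e)%:C by rewrite RRe_real// gtr0_real.
rewrite eE ltcR in e0; have e20 : 0 < complex.Re e / 2 by rewrite divr_gt0.
have {}ga := ga _ e20; have {}gb := gb _ e20.
near=> t; rewrite eE [ltLHS](_ : _ = (normc ((a +i* b : C) - g t))%:C)//.
rewrite ltcR (le_lt_trans (normc_le_ReIm _))// [ltRHS]splitr.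
by apply: ltrD; [near: t; apply: filterS ga|near: t; apply: filterS gb] => t;
  case: (g t).
Unshelve. all: by end_near. Qed.

Lemma cvg_real_complex T (F : set_system T) (FF : Filter F) (g : T -> R) (a : R) :
  g @ F --> a -> (fun t => (g t)%:C : C) @ F --> (a%:C : C).
Proof. by move=> ga; apply: cvg_complex => //=; exact: cvg_cst. Qed.

(** An ultrafilter converges along a bounded function: a cluster point of the
    image in a segment is a limit, since a neighborhood whose preimage is not
    in [U] has a complement whose preimage is. *)
Lemma ultra_cvg_bounded T (U : set_system T) (UU : UltraFilter U) (g : T -> R)
  (M : R) : (forall t, `|g t| <= M) -> exists a : R, g @ U --> a.
Proof.
move=> gM; have : compact `[- M, M]%classic by exact: segment_compact.
move=> /(_ (g @ U) _) cU.
have gU : (g @ U) `[- M, M]%classic.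
  by apply: (@filterE _ U) => t /=; rewrite in_itv /= -ler_norml.
have [a [_ aU]] := cU gU; exists a => B aB.
have [//|nB] := in_ultra_setVsetC (g @^-1` B) UU.
by have [x [nBx Bx]] := aU (~` B) B nB aB.
Qed.

Lemma ultra_cvgc_bounded T (U : set_system T) (UU : UltraFilter U) (g : T -> C)
  (M : R) : (forall t, normc (g t) <= M) -> cvg (g @ U).
Proof.
move=> gM.
have [a ga] := ultra_cvg_bounded UU (fun t => le_trans (Re_le_normc (g t)) (gM t)).
have [b gb] := ultra_cvg_bounded UU (fun t => le_trans (Im_le_normc (g t)) (gM t)).
by apply/cvg_ex; exists (a +i* b); exact: cvg_complex.
Qed.

Lemma normc_sum I (r : seq I) (P : pred I) (F : I -> R[i]) :
  normc (\sum_(i <- r | P i) F i) <= \sum_(i <- r | P i) normc (F i).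
Proof.
elim/big_ind2: _ => [|x a y b xa yb|//]; first by rewrite normc0.
exact: le_trans (le_normcD _ _) (lerD xa yb).
Qed.

Lemma lim_normc_le T (F : set_system T) (FF : ProperFilter F) (g : T -> C) (a : C)
  (B : R) : g @ F --> a -> (\forall t \near F, normc (g t) <= B) -> normc a <= B.
Proof.
move=> /cvgrPdist_lt ga gB; rewrite leNgt; apply/negP => aB.
have e0 : 0 < (normc a - B)%:C :> R[i] by rewrite ltcR subr_gt0.
have [t [tB]] : exists t, normc (g t) <= B /\ `|a - g t| < (normc a - B)%:C.
  by apply: (@filter_ex _ F); apply: filterI => //; exact: ga.
rewrite [ltLHS](_ : _ = (normc (a - g t))%:C)// ltcR ltNge => /negP; apply.
have := le_normcD (a - g t) (g t); rewrite subrK; lra.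
Qed.

Section series.
Variables (c : nat -> C) (B : R).
Hypothesis cB : forall m, \sum_(0 <= k < m) normc (c k) <= B.

(** Completeness of the complex numbers is obtained from that of [R] by
    treating real and imaginary parts separately. *)
Lemma cvg_series_normc : cvgn (series c).
Proof.
have cn : cvgn (series (fun k => normc (c k))).
  apply: nondecreasing_is_cvgn.
    by apply/nondecreasing_series => k _ _; exact: normc_ge0.
  by exists B => _ [m _ <-]; exact: cB.
have cRe : cvgn (series (fun k => complex.Re (c k))).
  apply: (@normed_cvg R R^o); apply: series_le_cvg cn => k //=; rewrite ?normc_ge0//.
  by rewrite Re_le_normc.
have cIm : cvgn (series (fun k => complex.Im (c k))).
  apply: (@normed_cvg R R^o); apply: series_le_cvg cn => k //=; rewrite ?normc_ge0//.
  by rewrite Im_le_normc.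
apply/cvg_ex; exists (limn (series (fun k => complex.Re (c k))) +i*
  limn (series (fun k => complex.Im (c k)))).
apply: cvg_complex.
  rewrite [X in X @ _](_ : _ = series (fun k => complex.Re (c k)))//.
  by apply/funext => m; rewrite /series/= raddf_sum.
rewrite [X in X @ _](_ : _ = series (fun k => complex.Im (c k)))//.
by apply/funext => m; rewrite /series/= raddf_sum.
Qed.

Lemma lim_series_normc : normc (limn (series c)) <= B.
Proof.
apply: lim_normc_le cvg_series_normc _; near=> m.
exact: le_trans (normc_sum _ _ _) (cB m).
Unshelve. all: by end_near. Qed.

End series.

Lemma lim_series_single (n : nat) (c : nat -> C) :
  limn (series (fun k => if k == n then c k else 0)) = c n.
Proof.
apply: cvg_lim => //; apply: cvg_near_cst; near=> m.
rewrite /series/= -big_mkcond/= big_mkord.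
have nm : (n < m)%N by near: m; exact: nbhs_infty_gt.
by rewrite (big_pred1 (Ordinal nm)).
Unshelve. all: by end_near. Qed.

Lemma cvgc_exprn T (F : set_system T) (FF : Filter F) (f : T -> C) (a : C) n :
  f @ F --> a -> (fun t => f t ^+ n) @ F --> a ^+ n.
Proof.
move=> fa; elim: n => [|n ih]; first by under eq_fun do rewrite expr0; exact: cvg_cst.
by under eq_fun do rewrite exprS; rewrite exprS; apply: cvgM ih.
Qed.

End complex_limits.

(** * The norm of l_p through partial sums *)

Section lp_sums.
Context {R : realType} {p : nat} (p1 : (1 <= p)%N).
Local Notation C := (R[i])^o.
Local Notation lpT := (lp R p1).

Definition lpn (x : lpT) : R := fine (lp_norm p x).

Lemma lpn_ge0 x : 0 <= lpn x.
Proof. exact/fine_ge0/lp_norm_ge0. Qed.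

Lemma lp_normr_lpn (x : lpT) : `|x| = (lpn x)%:C.
Proof. by []. Qed.

Lemma unit_ball_lpn (x : lpT) : unit_ball x = (lpn x < 1) :> Prop.
Proof. by rewrite unit_ballE lp_normr_lpn -[1]/(1%:C) ltcR. Qed.

Lemma powR_invK (s : R) : 0 <= s -> (s `^ (p%:R^-1)) ^+ p = s.
Proof.
move=> s0; rewrite -powR_mulrn ?powR_ge0// -powRrM mulVf ?powRr1//.
by rewrite pnatr_eq0 -lt0n.
Qed.

Lemma lp_series_ge0 (x : nat -> C) : (0 <= \sum_(0 <= k <oo) (normc (x k) ^+ p)%:E)%E.
Proof. by apply: nneseries_ge0 => k _ _; rewrite lee_fin exprn_ge0// normc_ge0. Qed.

Lemma lp_seriesE (x : lpT) :
  (\sum_(0 <= k <oo) (normc (x k) ^+ p)%:E)%E = (lpn x ^+ p)%:E.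
Proof.
pose S : \bar R := (\sum_(0 <= k <oo) (normc (x k) ^+ p)%:E)%E.
have S0 : (0 <= S)%E by exact: lp_series_ge0.
have xS : lp_norm p x = (S `^ p%:R^-1)%E by exact: lp_normE.
rewrite -/S; clearbody S; have := lp_fin_num x; rewrite /lpn xS.
case: S S0 {xS} => [s|_|//].
  by rewrite lee_fin poweR_EFin /= => s0 _; rewrite powR_invK.
by rewrite poweRyr// invr_neq0// pnatr_eq0 -lt0n.
Qed.

Lemma lp_partial_sum (x : lpT) m :
  \sum_(0 <= k < m) normc (x k) ^+ p <= lpn x ^+ p.
Proof.
rewrite -lee_fin -lp_seriesE -sumEFin; apply: nneseries_lim_ge => k _ _.
by rewrite lee_fin exprn_ge0// normc_ge0.
Qed.

Lemma lp_series_le (x : nat -> C) (B : R) :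
    (forall m, \sum_(0 <= k < m) normc (x k) ^+ p <= B) ->
  (\sum_(0 <= k <oo) (normc (x k) ^+ p)%:E <= B%:E)%E.
Proof.
move=> xB; apply: lime_le.
  by apply: is_cvg_nneseries => k _ _; rewrite lee_fin exprn_ge0// normc_ge0.
by near=> m; rewrite sumEFin lee_fin.
Unshelve. all: by end_near. Qed.

Lemma lp_summable_bounded (x : nat -> C) (B : R) :
    (forall m, \sum_(0 <= k < m) normc (x k) ^+ p <= B) ->
  x \in @lp_summable R p.
Proof.
move=> /lp_series_le xB; rewrite inE /= lp_normE//.
by rewrite poweR_lty// (le_lt_trans xB)// ltry.
Qed.

Lemma lpnX_le (x : lpT) (B : R) :
    (forall m, \sum_(0 <= k < m) normc (x k) ^+ p <= B) -> lpn x ^+ p <= B.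
Proof. by move=> /lp_series_le; rewrite lp_seriesE lee_fin. Qed.

Lemma lpnX_cvg (x : lpT) :
  \sum_(0 <= k < m) normc (x k) ^+ p @[m --> \oo] --> lpn x ^+ p.
Proof.
have cx : cvgn (fun m => \sum_(0 <= k < m) normc (x k) ^+ p).
  apply: nondecreasing_is_cvgn.
    by apply/(@nondecreasing_series _ (fun k => normc (x k) ^+ p) xpredT) => k _ _;
      rewrite exprn_ge0// normc_ge0.
  by exists (lpn x ^+ p) => _ [m _ <-]; exact: lp_partial_sum.
have := cx; rewrite (_ : limn _ = lpn x ^+ p)//; apply/eqP; rewrite eq_le.
apply/andP; split.
  by apply: limr_le => //; near=> m; exact: lp_partial_sum.
apply: lpnX_le => m; apply: nondecreasing_cvgn_le => //.
by apply/(@nondecreasing_series _ (fun k => normc (x k) ^+ p) xpredT) => k _ _;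
  rewrite exprn_ge0// normc_ge0.
Unshelve. all: by end_near. Qed.

Lemma lp_coord_le (x : lpT) k : normc (x k) <= lpn x.
Proof.
rewrite -(@ler_pXn2r _ p) ?nnegrE ?normc_ge0 ?lpn_ge0//.
apply: le_trans (lp_partial_sum x k.+1); rewrite big_nat_recr//= lerDr.
by apply: sumr_ge0 => i _; rewrite exprn_ge0// normc_ge0.
Qed.

Lemma lp_coord_cvg0 (x : lpT) : normc (x k) ^+ p @[k --> \oo] --> 0.
Proof.
by apply: (@cvg_series_cvg_0 _ R^o); apply/cvg_ex; eexists; exact: lpnX_cvg.
Qed.

End lp_sums.

(** * Inequalities for powers *)

Section power_estimates.
Context {R : realType}.
Implicit Types (x h : R[i]) (a v e : R) (p : nat).

Lemma normcX x p : normc (x ^+ p) = normc x ^+ p.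
Proof.
by elim: p => [|p ih]; rewrite ?expr0 ?normc1// !exprS normcM ih.
Qed.

Lemma normc_real a : normc a%:C = `|a|.
Proof. by rewrite /normc /= expr0n addr0 sqrtr_sqr. Qed.

Lemma normc_nat n : normc (n%:R : R[i]) = n%:R.
Proof. by rewrite -(rmorph_nat (real_complex R)) normc_real ger0_norm. Qed.

Lemma normc_conj (c : R[i]) : normc c^* = normc c.
Proof. by case: c => u v /=; rewrite sqrrN. Qed.

(** The weak constant is harmless, as it only enters Lipschitz and remainder
    bounds. *)
Lemma powerD_le p a v : 0 <= a -> 0 <= v -> (a + v) ^+ p <= 2 ^+ p * (a ^+ p + v ^+ p).
Proof.
wlog av : a v / a <= v => [H a0 v0|a0 v0].
  have [/H|/ltW/H] := leP a v; first exact.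
  by rewrite (addrC v) (addrC (v ^+ p)); exact.
rewrite (@le_trans _ _ ((2 * v) ^+ p))//.
  by rewrite lerXn2r ?nnegrE ?addr_ge0 ?mulr_ge0//; lra.
by rewrite exprMn ler_wpM2l ?exprn_ge0// lerDr exprn_ge0.
Qed.

(** The graph of [t |-> t ^ p.+1] lies above its tangent at [u].  The induction
    rests on the fact that the defect at [p.+1] is [x] times the defect at [p]
    plus a multiple of [(x - u) ^ 2]. *)
Lemma power_tangent p (u x : R) : 0 <= u -> 0 <= x ->
  p.+1%:R * u ^+ p * (x - u) <= x ^+ p.+1 - u ^+ p.+1.
Proof.
move=> u0 x0; rewrite -subr_ge0; elim: p => [|p ih].
  by rewrite !expr1 expr0 !mul1r subrr.
have -> : x ^+ p.+2 - u ^+ p.+2 - p.+2%:R * u ^+ p.+1 * (x - u) =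
    x * (x ^+ p.+1 - u ^+ p.+1 - p.+1%:R * u ^+ p * (x - u))
    + p.+1%:R * u ^+ p * (x - u) ^+ 2.
  by rewrite -[in p.+2%:R]natr1 !exprS expr0; ring.
apply: addr_ge0; first exact: mulr_ge0.
by apply: mulr_ge0; rewrite ?sqr_ge0 ?mulr_ge0 ?exprn_ge0.
Qed.

(** Writing the increment as [|h| <= e * v] separates its size [e], which comes
    out linearly, from its shape [v], which stays inside a [p]-th power.  For
    sequences this replaces the use of Hoelder's inequality: [v] is then
    proportional to the coordinates of [h] and has norm at most [1]. *)
Lemma power_increment p x h e v : 0 <= v -> 0 <= e <= 1 -> normc h <= e * v ->
  normc ((x + h) ^+ p - x ^+ p) <= e * ((normc x + v) ^+ p - normc x ^+ p).
Proof.
move=> v0 /andP[e0 e1] hv; have x0 := normc_ge0 x.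
elim: p => [|p ih]; first by rewrite !expr0 !subrr normc0 mulr0.
have d0 : 0 <= (normc x + v) ^+ p - normc x ^+ p.
  by rewrite subr_ge0 lerXn2r ?nnegrE ?addr_ge0// lerDl.
have -> : (x + h) ^+ p.+1 - x ^+ p.+1 =
    (x + h) * ((x + h) ^+ p - x ^+ p) + h * x ^+ p by rewrite !exprS; ring.
have -> : (normc x + v) ^+ p.+1 - normc x ^+ p.+1 =
    (normc x + v) * ((normc x + v) ^+ p - normc x ^+ p) + v * normc x ^+ p.
  by rewrite !exprS; ring.
rewrite (le_trans (le_normcD _ _))// [leRHS]mulrDr lerD//.
  rewrite normcM mulrCA ler_pM ?normc_ge0//.
  by rewrite (le_trans (le_normcD _ _))// lerD2l (le_trans hv)// ler_piMl.
by rewrite normcM normcX mulrA ler_wpM2r// exprn_ge0.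
Qed.

(** Same device as in [power_increment], at second order: the factor [e ^ 2] is
    what makes the remainder negligible. *)
Lemma power_taylor1 p x h e v : 0 <= v -> 0 <= e <= 1 -> normc h <= e * v ->
  normc ((x + h) ^+ p.+1 - x ^+ p.+1 - p.+1%:R * x ^+ p * h) <=
  e ^+ 2 * ((normc x + v) ^+ p.+1 - normc x ^+ p.+1 - p.+1%:R * normc x ^+ p * v).
Proof.
move=> v0 /andP[e0 e1] hv; have x0 := normc_ge0 x.
elim: p => [|p ih].
  rewrite !expr1 !expr0 !mulr1 !mul1r.
  rewrite (_ : x + h - x - h = 0); last by ring.
  rewrite (_ : normc x + v - normc x - v = 0); last by ring.
  by rewrite normc0 mulr0.
have d0 : 0 <= (normc x + v) ^+ p.+1 - normc x ^+ p.+1 - p.+1%:R * normc x ^+ p * v.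
  rewrite subr_ge0; have := @power_tangent p (normc x) (normc x + v).
  by rewrite [in X in _ * X]addrC addKr; apply => //; rewrite addr_ge0.
have -> : (x + h) ^+ p.+2 - x ^+ p.+2 - p.+2%:R * x ^+ p.+1 * h =
    (x + h) * ((x + h) ^+ p.+1 - x ^+ p.+1 - p.+1%:R * x ^+ p * h)
    + p.+1%:R * x ^+ p * h ^+ 2.
  by rewrite -[in p.+2%:R]natr1 !exprS expr0; ring.
have -> : (normc x + v) ^+ p.+2 - normc x ^+ p.+2 - p.+2%:R * normc x ^+ p.+1 * v =
    (normc x + v) *
      ((normc x + v) ^+ p.+1 - normc x ^+ p.+1 - p.+1%:R * normc x ^+ p * v)
    + p.+1%:R * normc x ^+ p * v ^+ 2.
  by rewrite -[in p.+2%:R]natr1 !exprS expr0; ring.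
rewrite (le_trans (le_normcD _ _))// [leRHS]mulrDr lerD//.
  rewrite normcM mulrCA ler_pM ?normc_ge0//.
  by rewrite (le_trans (le_normcD _ _))// lerD2l (le_trans hv)// ler_piMl.
rewrite (normcM _ (h ^+ 2)) (normcM _ (x ^+ p)) !normcX normc_nat [leRHS]mulrCA -exprMn ler_wpM2l ?mulr_ge0 ?exprn_ge0//.
by rewrite lerXn2r ?nnegrE ?normc_ge0 ?mulr_ge0.
Qed.

End power_estimates.

(** Inequality of arithmetic and geometric means for [m] copies of [u] and one
    copy of [v]. *)
Lemma prod_le1_of_mean (R : realFieldType) (m : nat) (u v : R) :
  0 <= u -> 0 <= v -> m%:R * u + v <= m.+1%:R -> u ^+ m * v <= 1.
Proof.
move=> u0 v0 uv.
pose E (i : 'I_m.+1) := if (i < m)%N then u else v.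
have E0 : {in [set: 'I_m.+1]%SET, forall i, 0 <= E i}.
  by move=> i _; rewrite /E; case: ifP.
have /leifP := leif_AGM E0.
have -> : \prod_(i in [set: 'I_m.+1]%SET) E i = u ^+ m * v.
  rewrite (eq_bigl xpredT) => [|i]; last by rewrite inE.
  rewrite big_ord_recr/= /E/= ltnn; congr (_ * _).
  by under eq_bigr => i _ do rewrite ltn_ord; rewrite prodr_const card_ord.
have -> : \sum_(i in [set: 'I_m.+1]%SET) E i = m%:R * u + v.
  rewrite (eq_bigl xpredT) => [|i]; last by rewrite inE.
  rewrite big_ord_recr/= /E/= ltnn; congr (_ + _).
  by under eq_bigr => i _ do rewrite ltn_ord; rewrite sumr_const card_ord mulr_natl.
rewrite cardsT card_ord => AGM.
have {}AGM : u ^+ m * v <= ((m%:R * u + v) / m.+1%:R) ^+ m.+1.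
  by move: AGM; case: ifP => _ => [/eqP->//|/ltW].
apply: (le_trans AGM); rewrite exprn_ile1//.
  by rewrite divr_ge0// addr_ge0// mulr_ge0.
by rewrite ler_pdivrMr ?ltr0n// mul1r.
Qed.

(** * Diagonal polynomials *)

Lemma differentiable_quadratic_remainder (K : numFieldType) (V W : normedModType K)
    (f : V -> W) (x : V) (D : {linear V -> W}) (M N : K) : 0 < M -> 0 < N ->
    (forall h, `|D h| <= M * `|h|) ->
    (forall h, `|h| <= 1 -> `|f (x + h) - f x - D h| <= N * `|h| ^+ 2) ->
  differentiable f x.
Proof.
move=> M0 N0 DM fN.
have Dc : continuous D.
  apply/linear_bounded_continuous/linear_boundedP.
  near=> r => h; rewrite (le_trans (DM h))// ler_wpM2r//.
  by near: r; apply: nbhs_pinfty_ge; exact: gtr0_real.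
have fD : f \o shift x = cst (f x) + D +o_ 0 id.
  apply/eqaddoP => e e0; near=> h.
  have h1 : `|h| <= 1 by near: h; exact: (@nbhs0_le _ V).
  rewrite /= !fctE /= opprD addrA [h + x]addrC (le_trans (fN h h1))//.
  rewrite expr2 mulrA ler_wpM2r// mulrC -ler_pdivlMr//.
  by near: h; apply: (@nbhs0_le _ V); rewrite divr_gt0.
have DE := diff_unique Dc fD.
by apply/diff_locallyP; rewrite DE.
Unshelve. all: by end_near. Qed.

Section diagonal_polynomial.
Context {R : realType} {p : nat} (p1 : (1 <= p)%N).
Local Notation C := (R[i])^o.
Local Notation lpT := (lp R p1).
Variable b : nat -> R[i].
Hypothesis b1 : forall k, normc (b k) <= 1.

Definition diagpoly (x : lpT) : C := limn (series (fun k => b k * x k ^+ p : C)).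

Definition diagdiff (x h : lpT) : C :=
  limn (series (fun k => b k * (p%:R * x k ^+ p.-1 * h k) : C)).

Lemma normc_diag_le k (c : R[i]) (B : R) : normc c <= B -> normc (b k * c) <= B.
Proof.
by move=> cB; rewrite normcM (le_trans _ cB)// ler_piMl ?normc_ge0.
Qed.

Lemma diagpoly_partial (x : lpT) m :
  \sum_(0 <= k < m) normc (b k * x k ^+ p) <= lpn x ^+ p.
Proof.
apply: le_trans (lp_partial_sum x m); apply: ler_sum => k _.
by apply: normc_diag_le; rewrite normcX.
Qed.

Lemma diagpoly_cvg (x : lpT) : cvgn (series (fun k => b k * x k ^+ p : C)).
Proof. exact: cvg_series_normc (diagpoly_partial x). Qed.

Definition diag_bound : R := 2 ^+ p * (1 + 1).

Lemma diag_bound_gt0 : 0 < diag_bound.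
Proof. by rewrite mulr_gt0 ?exprn_gt0// addr_gt0. Qed.

(** All the series attached to [P_b] at [x] with increment [h] are dominated by
    this one, multiplied by a power of [e]. *)
Lemma dominated_sum (x h : lpT) (e : R) m : lpn x <= 1 -> 0 < e -> lpn h <= e ->
  \sum_(0 <= k < m) (normc (x k) + e^-1 * normc (h k)) ^+ p <= diag_bound.
Proof.
move=> x1 e0 he.
apply: (@le_trans _ _ (\sum_(0 <= k < m)
    2 ^+ p * (normc (x k) ^+ p + e^-1 ^+ p * normc (h k) ^+ p))).
  apply: ler_sum => k _; rewrite -exprMn; apply: powerD_le; first exact: normc_ge0.
  by rewrite mulr_ge0 ?normc_ge0 ?invr_ge0// ltW.
rewrite -mulr_sumr big_split/= -mulr_sumr ler_wpM2l ?exprn_ge0//.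
apply: lerD; first by rewrite (le_trans (lp_partial_sum x m))// exprn_ile1// lpn_ge0.
rewrite exprVn mulrC ler_pdivrMr ?exprn_gt0// mul1r.
rewrite (le_trans (lp_partial_sum h m))// lerXn2r ?nnegrE ?lpn_ge0//.
exact: ltW.
Qed.

Lemma dominated_sum_le (x h : lpT) (e c : R) (d : nat -> R[i]) m :
    lpn x <= 1 -> 0 < e -> lpn h <= e -> 0 <= c ->
    (forall k, normc (d k) <= c * (normc (x k) + e^-1 * normc (h k)) ^+ p) ->
  \sum_(0 <= k < m) normc (b k * d k) <= c * diag_bound.
Proof.
move=> x1 e0 he c0 dc; have := dominated_sum m x1 e0 he.
move=> /(ler_wpM2l c0); apply: le_trans; rewrite mulr_sumr.
by apply: ler_sum => k _; exact: normc_diag_le.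
Qed.

Lemma normc_scaled (h : lpT) (e : R) k : 0 < e ->
  (normc (h k) <= e * (e^-1 * normc (h k))) && (0 <= e^-1 * normc (h k)).
Proof.
by move=> e0; rewrite mulrA divff ?gt_eqF// mul1r lexx mulr_ge0 ?normc_ge0 ?invr_ge0// ltW.
Qed.

Lemma diagdiff_partial (x h : lpT) (e : R) m : lpn x <= 1 -> 0 < e -> lpn h <= e ->
  \sum_(0 <= k < m) normc (b k * (p%:R * x k ^+ p.-1 * h k)) <= e * diag_bound.
Proof.
move=> x1 e0 he; apply: (dominated_sum_le m x1 e0 he (ltW e0)) => k.
have /andP[hv v0] := normc_scaled h k e0.
set v := _ * normc (h k) in hv v0 *.
rewrite (normcM _ (h k)) (normcM _ (x k ^+ _)) normcX normc_nat.
apply: (@le_trans _ _ (p%:R * normc (x k) ^+ p.-1 * (e * v))).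
  by rewrite ler_wpM2l// mulr_ge0// exprn_ge0// normc_ge0.
rewrite mulrCA ler_wpM2l ?(ltW e0)//.
have := @power_tangent R p.-1 (normc (x k)) (normc (x k) + v) (normc_ge0 _).
rewrite prednK// [in X in _ * X]addrC addKr => /(_ (addr_ge0 (normc_ge0 _) v0)).
by move=> /le_trans; apply; rewrite gerBl exprn_ge0// normc_ge0.
Qed.

Lemma diagdiff_cvg (x h : lpT) : lpn x <= 1 ->
  cvgn (series (fun k => b k * (p%:R * x k ^+ p.-1 * h k) : C)).
Proof.
move=> x1; have h0 : 0 < lpn h + 1 by rewrite ltr_wpDl ?lpn_ge0.
by apply: (cvg_series_normc (fun m => diagdiff_partial m x1 h0 _)); rewrite lerDl.
Qed.

Lemma diagdiff_le (x h : lpT) (e : R) : lpn x <= 1 -> 0 < e -> lpn h <= e ->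
  normc (diagdiff x h) <= e * diag_bound.
Proof.
by move=> x1 e0 he; exact: (lim_series_normc (fun m => diagdiff_partial m x1 e0 he)).
Qed.

Lemma diagdiff_linear (x : lpT) : lpn x <= 1 -> linear (diagdiff x).
Proof.
move=> x1 a h h'; rewrite /diagdiff.
rewrite -(lim_seriesZ a (diagdiff_cvg (h := h) x1)) -lim_seriesD; last 2 first.
- exact: is_cvg_seriesZ (diagdiff_cvg (h := h) x1).
- exact: diagdiff_cvg.
congr (limn (series _)); apply/funext => k.
rewrite -[LHS]/(b k * (p%:R * x k ^+ p.-1 * (a * h k + h' k))).
rewrite -[RHS]/(a * (b k * (p%:R * x k ^+ p.-1 * h k)) +
  b k * (p%:R * x k ^+ p.-1 * h' k)).
ring.
Qed.

Lemma diag_termsB (x y : lpT) : (fun k => b k * (x k ^+ p - y k ^+ p) : C) =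
  (fun k => b k * x k ^+ p : C) - (fun k => b k * y k ^+ p : C).
Proof. by apply/funext => k; rewrite !fctE /= mulrBr. Qed.

Lemma diagpolyB (x y : lpT) : diagpoly x - diagpoly y =
  limn (series (fun k => b k * (x k ^+ p - y k ^+ p) : C)).
Proof.
rewrite diag_termsB.
by rewrite (lim_seriesB (diagpoly_cvg (x := x)) (diagpoly_cvg (x := y))).
Qed.

Lemma diagpoly_increment (x h : lpT) (e : R) : lpn x <= 1 -> 0 < e <= 1 -> lpn h <= e ->
  normc (diagpoly (x + h) - diagpoly x) <= e * diag_bound.
Proof.
move=> x1 /andP[e0 e1] he; rewrite diagpolyB.
apply: lim_series_normc => m.
apply: (dominated_sum_le m x1 e0 he (ltW e0)) => k.
have /andP[hv v0] := normc_scaled h k e0.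
have e01 : 0 <= e <= 1 by rewrite (ltW e0).
apply: (le_trans (@power_increment R p (x k) _ _ _ v0 e01 hv)).
by rewrite ler_wpM2l ?(ltW e0)// gerBl exprn_ge0// normc_ge0.
Qed.

Lemma diagpoly_taylor (x h : lpT) (e : R) : lpn x <= 1 -> 0 < e <= 1 -> lpn h <= e ->
  normc (diagpoly (x + h) - diagpoly x - diagdiff x h) <= e ^+ 2 * diag_bound.
Proof.
move=> x1 /andP[e0 e1] he; rewrite diagpolyB /diagdiff -lim_seriesB; last 2 first.
- rewrite diag_termsB.
  exact: is_cvg_seriesB (diagpoly_cvg (x := x + h)) (diagpoly_cvg (x := x)).
- exact: diagdiff_cvg.
rewrite (_ : (_ - _) = fun k => b k * ((x k + h k) ^+ p - x k ^+ p
    - p%:R * x k ^+ p.-1 * h k)); last first.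
  by apply/funext => k; rewrite [RHS]mulrBr.
apply: lim_series_normc => m.
apply: (dominated_sum_le m x1 e0 he (sqr_ge0 _)) => k.
have /andP[hv v0] := normc_scaled h k e0.
have e01 : 0 <= e <= 1 by rewrite (ltW e0).
have := @power_taylor1 R p.-1 (x k) _ _ _ v0 e01 hv; rewrite prednK// => /le_trans.
apply; rewrite ler_wpM2l ?sqr_ge0// -addrA -opprD gerBl addr_ge0//.
  by rewrite exprn_ge0// normc_ge0.
by rewrite mulr_ge0// mulr_ge0// exprn_ge0// normc_ge0.
Qed.

Lemma differentiable_diagpoly (x : lpT) : lpn x <= 1 ->
  differentiable (diagpoly : lpT -> C) x.
Proof.
move=> x1; have K0 : 0 < diag_bound%:C :> R[i] by rewrite ltcR diag_bound_gt0.
pose D : {linear lpT -> C} := HB.pack (diagdiff x)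
  (GRing.isLinear.Build _ _ _ _ _ (diagdiff_linear x1)).
have h0P (h : lpT) : h = 0 \/ 0 < lpn h.
  have [/eqP h0|h0] := eqVneq (lpn h) 0.
    by left; apply/normr0_eq0; rewrite lp_normr_lpn (eqP h0).
  by right; rewrite lt0r h0 lpn_ge0.
apply: (differentiable_quadratic_remainder (D := D) K0 K0) => h.
  have [->|h0] := h0P h; first by rewrite linear0 !normr0 mulr0.
  rewrite lp_normr_lpn [leLHS](_ : _ = (normc (diagdiff x h))%:C)// -rmorphM lecR.
  by rewrite mulrC diagdiff_le.
have [->|h0] := h0P h.
  by rewrite addr0 subrr linear0 subr0 !normr0 expr0n mulr0.
rewrite lp_normr_lpn -[1]/(1%:C) lecR => h1.
rewrite [leLHS](_ : _ = (normc (diagpoly (x + h) - diagpoly x - diagdiff x h))%:C)//.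
rewrite -rmorphXn -rmorphM lecR mulrC diagpoly_taylor//.
by rewrite h0.
Qed.

Lemma diagpoly_Au : sigL (@unit_ball _ lpT) diagpoly \in @Au_pred R lpT.
Proof.
rewrite inE; split.
  apply: holomorphic_sigL => x; rewrite unit_ball_lpn => /ltW.
  exact: differentiable_diagpoly.
apply/unif_continuous_ballP => e e0.
have eE : e = (complex.Re e)%:C by rewrite RRe_real// gtr0_real.
rewrite eE ltcR in e0.
pose d := Num.min 1 (complex.Re e / (2 * diag_bound)).
have K0 := diag_bound_gt0.
have d0 : 0 < d by rewrite lt_min ltr01 divr_gt0// mulr_gt0.
exists d%:C; first by rewrite ltcR.
move=> x y; rewrite distrC lp_normr_lpn ltcR => /ltW xyd.
have /ltW x1 : lpn (val x) < 1 by rewrite -unit_ball_lpn; exact: set_valP.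
have d1 : 0 < d <= 1 by rewrite d0 ge_min lexx.
rewrite distrC eE [ltLHS](_ : _ = (normc (diagpoly (val y) - diagpoly (val x)))%:C)//.
rewrite ltcR; have := diagpoly_increment x1 d1 xyd; rewrite subrKC => /le_lt_trans.
apply; apply: (@le_lt_trans _ _ (complex.Re e / (2 * diag_bound) * diag_bound)).
  by rewrite ler_wpM2r ?(ltW K0)// ge_min lexx orbT.
rewrite invfM -!mulrA mulVf ?gt_eqF// mulr1; lra.
Qed.

Definition diag_Au : Au lpT := MkAu diagpoly_Au.

End diagonal_polynomial.

(** * Homomorphisms given by ultrafilters *)

Section spectrum.
Context {R : realType} (V : normedModType R[i]).
Local Notation C := (R[i])^o.

Lemma Au_valX (f : Au V) m (x : @unit_ball R V) : (f ^+ m) x = f x ^+ m.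
Proof. by elim: m => [//|m ih]; rewrite !exprS -ih. Qed.

Lemma spectrumB (phi : Au V -> C) :
  spectrum phi -> {morph phi : f g / f - g}.
Proof.
move=> [lin _ _] f g; have := lin (-1) g f.
by rewrite !scaleN1r [f - g]addrC => ->; rewrite [LHS]addrC.
Qed.

Lemma spectrumZ (phi : Au V -> C) :
  spectrum phi -> forall a f, phi (a *: f) = a * phi f.
Proof.
move=> phis a f; have := spectrumB phis 0 0; rewrite !subrr => phi0.
by have [lin _ _] := phis; rewrite -[a *: f]addr0 lin phi0 addr0.
Qed.

Lemma spectrumD (phi : Au V -> C) :
  spectrum phi -> {morph phi : f g / f + g}.
Proof. by move=> [lin _ _] f g; have := lin 1 f g; rewrite !scale1r. Qed.

(** A homomorphism is nonzero at some [f], and [1 * f = f]. *)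
Lemma spectrum1 (phi : Au V -> C) :
  spectrum phi -> phi 1 = 1.
Proof.
move=> [lin mor phi0]; have [f phif] : exists f, phi f != 0.
  apply: contrapT => /forallNP phi00; apply: phi0; apply/funext => f.
  by have /negP/negPn/eqP := phi00 f.
by apply: (mulIf phif); rewrite -mor !mul1r.
Qed.

Lemma spectrumX (phi : Au V -> C) :
  spectrum phi -> forall f m, phi (f ^+ m) = phi f ^+ m.
Proof.
move=> phis f; elim=> [|m ih]; first by rewrite !expr0 spectrum1.
by have [_ mor _] := phis; rewrite !exprS mor ih.
Qed.

End spectrum.

Section ultrafilter_evaluation.
Context {R : realType} (V : normedModType R[i]).
Local Notation C := (R[i])^o.
Variables (U : set_system nat) (y : nat -> @unit_ball R V).

Definition ueval (f : Au V) : C := lim (f (y n) @[n --> U]).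

Hypothesis UU : UltraFilter U.

Lemma Au_bounded (f : Au V) : exists M : R, forall x, normc (f x) <= M.
Proof.
have : Au_fun f \in @Au_pred R V by exact: valP.
rewrite inE => -[_ /unif_continuous_bounded[M M0 fM]]; exists (complex.Re M) => x.
have := fM x; rewrite -[M]RRe_real ?gtr0_real// [ltLHS](_ : _ = (normc (f x))%:C)//.
by rewrite ltcR => /ltW; rewrite RRe_real ?gtr0_real.
Qed.

Lemma ueval_cvg (f : Au V) : f (y n) @[n --> U] --> ueval f.
Proof.
have [M fM] := Au_bounded f.
exact: (ultra_cvgc_bounded UU (fun n => fM (y n))).
Qed.

Lemma ueval_lim (f : Au V) (a : C) : f (y n) @[n --> U] --> a -> ueval f = a.
Proof. by move=> fa; apply: cvg_lim. Qed.

Lemma ueval_linear : linear ueval.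
Proof.
move=> a f g; apply: ueval_lim.
exact: cvgD (cvgZl_tmp (k := a) (ueval_cvg (f := f))) (ueval_cvg (f := g)).
Qed.

Lemma uevalM : {morph ueval : f g / f * g}.
Proof. by move=> f g; apply: ueval_lim; exact: cvgM (ueval_cvg (f := f)) (ueval_cvg (f := g)). Qed.

Lemma ueval1 : ueval 1 = 1.
Proof. by apply: ueval_lim; exact: cvg_cst. Qed.

Lemma ueval_spectrum : spectrum ueval.
Proof.
split; [exact: ueval_linear|exact: uevalM|].
move=> /(congr1 (fun phi : Au V -> C => phi 1)); rewrite ueval1 => /eqP.
by rewrite oner_eq0.
Qed.

End ultrafilter_evaluation.

(** * Unit vectors are weakly null *)

Section unit_vectors.
Context {R : realType} {p : nat} (p1 : (1 <= p)%N).
Local Notation C := (R[i])^o.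
Local Notation lpT := (lp R p1).

Definition delta (n k : nat) : C := (k == n)%:R.

Lemma sum_delta (a : R) n m : 0 <= a ->
  \sum_(0 <= k < m) (if k == n then a else 0) <= a.
Proof.
move=> a0; rewrite -big_mkcond/= big_mkord.
have [nm|mn] := ltnP n m.
  by rewrite (big_pred1 (Ordinal nm)).
rewrite big1// => i /eqP iE; by have := ltn_ord i; rewrite iE ltnNge mn.
Qed.

Lemma delta_partial n m : \sum_(0 <= k < m) normc (delta n k) ^+ p <= 1.
Proof.
apply: le_trans (sum_delta n m ler01); apply: ler_sum => k _.
rewrite /delta; case: (k == n); first by rewrite normc1 expr1n.
by rewrite normc0 expr0n gtn_eqF.
Qed.

Definition unitv n : lpT := Lp p1 (lp_summable_bounded p1 (delta_partial n)).

Lemma unitv_le1 n : lpn (unitv n) <= 1.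
Proof.
have /(lpnX_le (x := unitv n)) := delta_partial n.
by rewrite -[leRHS](expr1n _ p) ler_pXn2r// nnegrE ?lpn_ge0.
Qed.

Lemma lp_val_sum (I : Type) (r : seq I) (F : I -> lpT) k :
  (\sum_(i <- r) F i) k = \sum_(i <- r) F i k.
Proof. by elim/big_rec2: _ => // i x y _ <-. Qed.

(** Equality holds in fact: the coordinates of the combination
    are the [a k] for [k < m], then [0]. *)
Lemma lpn_comb (a : nat -> C) m :
  lpn (\sum_(0 <= k < m) a k *: unitv k) ^+ p <= \sum_(0 <= k < m) normc (a k) ^+ p.
Proof.
set w := \sum_(0 <= k < m) _.
have E k : w k = if (k < m)%N then a k else 0.
  rewrite lp_val_sum (eq_bigr (fun i => if i == k then a i else 0)); last first.
    move=> i _; rewrite [LHS](_ : _ = a i * delta i k)// /delta eq_sym.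
    by case: eqP; rewrite ?mulr1 ?mulr0.
  rewrite -big_mkcond/= big_mkord; case: ltnP => [km|mk].
    by rewrite (big_pred1 (Ordinal km)).
  by rewrite big1// => i /eqP iE; have := ltn_ord i; rewrite iE ltnNge mk.
apply: lpnX_le => j.
rewrite (@le_trans _ _ (\sum_(0 <= k < m + j) normc (w k) ^+ p))//.
  rewrite addnC (big_cat_nat (leq0n j) (leq_addr m j))/= lerDl.
  by apply: sumr_ge0 => k _; rewrite exprn_ge0// normc_ge0.
rewrite (big_cat_nat (leq0n m) (leq_addr j m))/= -[leRHS]addr0 lerD//.
  by rewrite !big_mkord; apply: ler_sum => k _; rewrite E ltn_ord.
rewrite big_nat big1// => k /andP[mk _].
by rewrite E ltnNge mk [LHS](_ : _ = normc 0 ^+ p)// normc0 expr0n gtn_eqF.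
Qed.

End unit_vectors.

Section weakly_null.
Context {R : realType} {p : nat} (p2 : (2 <= p)%N).
Local Notation C := (R[i])^o.
Local Notation p1 := (ltnW p2).
Local Notation lpT := (lp R p1).
Variable l : {linear lpT -> C}.
Hypothesis lc : continuous l.

Lemma dual_bound : exists2 M : R, 0 < M & forall x, normc (l x) <= M * lpn x.
Proof.
have /linear_boundedP/pinfty_ex_gt0[M M0 lM] := continuous_linear_bounded 0 (@lc 0).
have ME : M = (complex.Re M)%:C by rewrite RRe_real// gtr0_real.
exists (complex.Re M); first by rewrite ME ltcR in M0.
by move=> x; have := lM x; rewrite ME lp_normr_lpn -rmorphM lecR.
Qed.

(** Test [l] on [v = \sum_(k < m) conj (l e_k) e_k], so that [l v] is the sum
    [s] of squares itself.  As [p >= 2] and the [|l e_k|] are bounded by the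
    norm [M] of [l], [|v| ^ p <= M ^ (p - 2) * s]; together with
    [s <= M * |v|] this gives [s <= M ^ 2]. *)
Lemma sum_sqr_dual_bounded : exists B : R, forall m,
  \sum_(0 <= k < m) normc (l (unitv p1 k)) ^+ 2 <= B.
Proof.
have [M M0 lM] := dual_bound; exists (M ^+ 2) => m.
set s := \sum_(0 <= k < m) _.
have s0 : 0 <= s by rewrite sumr_ge0// => k _; rewrite sqr_ge0.
pose a k : C := (l (unitv p1 k))^*.
pose v : lpT := \sum_(0 <= k < m) a k *: unitv p1 k.
have lv : l v = s%:C.
  rewrite /v linear_sum rmorph_sum /=; apply: eq_bigr => k _.
  rewrite linearZ/= [LHS]mulrC [LHS](_ : _ = l (unitv p1 k) * (l (unitv p1 k))^*)//.
  by rewrite -sqr_normc rmorphXn.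
have sv : s <= M * lpn v.
  by have := lM v; rewrite lv normc_real ger0_norm.
have aE k : normc (a k) = normc (l (unitv p1 k)) by exact: normc_conj.
have aM k : normc (a k) <= M.
  by rewrite aE (le_trans (lM _))// ler_piMr ?(ltW M0)// unitv_le1.
have vs : lpn v ^+ p <= M ^+ p.-2 * s.
  apply: (le_trans (lpn_comb p1 a m)); rewrite mulr_sumr.
  apply: ler_sum => k _; rewrite -aE -[in leLHS](subnK p2) subn2 exprD.
  by rewrite ler_wpM2r ?sqr_ge0// lerXn2r ?nnegrE ?normc_ge0// ltW.
rewrite leNgt; apply/negP => Ms.
have s1 : 0 < s by rewrite (le_lt_trans _ Ms)// sqr_ge0.
have : s ^+ p <= M ^+ p * (M ^+ p.-2 * s).
  rewrite (@le_trans _ _ ((M * lpn v) ^+ p))//.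
    by rewrite lerXn2r ?nnegrE// mulr_ge0 ?lpn_ge0// ltW.
  by rewrite exprMn ler_wpM2l// exprn_ge0// ltW.
have -> : s ^+ p = s ^+ p.-1 * s by rewrite -exprSr prednK// ltnW.
rewrite mulrA ler_pM2r// -exprD (_ : (p + p.-2 = 2 * p.-1)%N); last first.
  lia.
rewrite exprM ler_pXn2r ?nnegrE ?sqr_ge0//; last by rewrite -ltnS (prednK (ltnW p2)).
by rewrite leNgt Ms.
Qed.

Lemma unitv_weakly_null : l (unitv p1 k) @[k --> \oo] --> (0 : C).
Proof.
have [B lB] := sum_sqr_dual_bounded.
have c0 : normc (l (unitv p1 k)) ^+ 2 @[k --> \oo] --> (0 : R).
  apply: (@cvg_series_cvg_0 _ R^o); apply: nondecreasing_is_cvgn.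
    by apply/nondecreasing_series => k _ _; exact: sqr_ge0.
  by exists B => _ [m _ <-]; exact: lB.
apply/cvgrPdist_lt => e e0.
have eE : e = (complex.Re e)%:C by rewrite RRe_real// gtr0_real.
rewrite eE ltcR in e0.
move/cvgrPdist_lt : c0 => /(_ (complex.Re e ^+ 2)) /=.
rewrite exprn_gt0// => /(_ isT); apply: filterS => k.
rewrite !sub0r !normrN ger0_norm ?sqr_ge0// ltr_pXn2r ?nnegrE ?normc_ge0 ?(ltW e0)//.
by rewrite eE -ltcR.
Qed.

End weakly_null.

(** * Homomorphisms in the fiber over z *)

Section approach_points.
Context {R : realType} {p : nat} (p2 : (2 <= p)%N).
Local Notation C := (R[i])^o.
Local Notation p1 := (ltnW p2).
Local Notation lpT := (lp R p1).
Variable z : lpT.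
Hypothesis z1 : unit_ball z.

Definition gap : R := 1 - lpn z ^+ p.

Lemma gap_gt0 : 0 < gap.
Proof.
move: z1; rewrite unit_ball_lpn subr_gt0 => zl1.
by rewrite exprn_ilt1 ?lpn_ge0// -lt0n ltnW.
Qed.

(** The factor [1 - 1 / (n + 1)] keeps the points in the open ball. *)
Definition radius n : R := (1 - n.+1%:R^-1) * (gap `^ (p%:R^-1)).

Lemma radius_factor n : 0 <= (1 - n.+1%:R^-1 : R) < 1.
Proof.
rewrite subr_ge0 invf_le1 ?ltr0n// ler1n/=.
by rewrite gtrBl invr_gt0 ltr0n.
Qed.

Lemma radiusX n : radius n ^+ p = (1 - n.+1%:R^-1) ^+ p * gap.
Proof. by rewrite exprMn powR_invK ?(ltW gap_gt0)//; exact: p1. Qed.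

Lemma radius_ge0 n : 0 <= radius n.
Proof. by rewrite mulr_ge0 ?powR_ge0//; have /andP[] := radius_factor n. Qed.

Lemma radiusX_lt n : radius n ^+ p < gap.
Proof.
rewrite radiusX gtr_pMl ?gap_gt0//; have /andP[t0 t1] := radius_factor n.
by rewrite exprn_ilt1// -lt0n ltnW.
Qed.

Lemma radius_factor_cvg : (1 - n.+1%:R^-1 : R) @[n --> \oo] --> (1 : R).
Proof.
rewrite -[X in _ --> X]subr0; apply: cvgB; first exact: cvg_cst.
exact: cvg_harmonic.
Qed.

Lemma radius_cvg : radius n @[n --> \oo] --> gap `^ (p%:R^-1).
Proof. by rewrite -[X in _ --> X]mul1r; apply: cvgMr_tmp radius_factor_cvg. Qed.

Lemma radiusX_cvg : radius n ^+ p @[n --> \oo] --> gap.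
Proof.
rewrite (_ : (fun n => _) = fun n => (1 - n.+1%:R^-1) ^+ p * gap); last first.
  by apply/funext => n; exact: radiusX.
rewrite -[X in _ --> X]mul1r; apply: cvgMr_tmp.
rewrite -[X in _ --> X](expr1n _ p).
exact: cvg_comp radius_factor_cvg (@exprn_continuous R p _).
Qed.

Definition approach n : lpT := z + ((radius n)%:C - z n) *: unitv p1 n.

Lemma approachE n k : approach n k = if k == n then (radius n)%:C else z k.
Proof.
rewrite [LHS](_ : _ = z k + ((radius n)%:C - z n) * delta n k)// /delta.
by case: eqP => [->|_]; rewrite ?mulr1 ?mulr0 ?addr0 ?subrKC.
Qed.

(** Replacing a coordinate increases the [p]-th power of the norm by less than
    [gap]. *)
Lemma approach_lt1 n : lpn (approach n) < 1.
Proof.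
rewrite -(@ltr_pXn2r _ p) ?nnegrE ?lpn_ge0 ?expr1n ?(ltnW p2)//.
apply: (@le_lt_trans _ _ (lpn z ^+ p + radius n ^+ p)); last first.
  by rewrite -ltrBrDl; exact: radiusX_lt.
have r0 : 0 <= radius n ^+ p by rewrite exprn_ge0// radius_ge0.
apply: lpnX_le => m.
apply: le_trans (lerD (lp_partial_sum z m) (sum_delta n m r0)).
rewrite -big_split; apply: ler_sum => k _; rewrite approachE.
rewrite [leRHS]/=; case: eqP => _; last by rewrite addr0.
by rewrite normc_real ger0_norm ?radius_ge0// lerDr exprn_ge0// normc_ge0.
Qed.

Lemma approach_ball n : unit_ball (approach n).
Proof. by rewrite unit_ball_lpn approach_lt1. Qed.

Definition approach_pt n : @unit_ball R lpT := SigSub (mem_set (approach_ball n)).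

Lemma lp_coord_cvg0C : (z k : C) @[k --> \oo] --> (0 : C).
Proof.
apply/cvgrPdist_lt => e e0.
have eE : e = (complex.Re e)%:C by rewrite RRe_real// gtr0_real.
rewrite eE ltcR in e0.
have /cvgrPdist_lt/(_ (complex.Re e ^+ p)) := lp_coord_cvg0 z.
rewrite exprn_gt0// => /(_ isT); apply: filterS => k.
rewrite !sub0r !normrN ger0_norm ?exprn_ge0 ?normc_ge0//.
rewrite ltr_pXn2r ?nnegrE ?normc_ge0 ?(ltW e0) ?(ltnW p2)//.
by rewrite eE -ltcR.
Qed.

Lemma approach_weak (l : {linear lpT -> C}) : continuous l ->
  l (approach n) @[n --> \oo] --> l z.
Proof.
move=> lc.
rewrite (_ : (fun n => _) =
    fun n => l z + ((radius n)%:C - z n : C) * l (unitv p1 n)); last first.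
  by apply/funext => n; rewrite /approach linearD linearZ.
rewrite -[X in _ --> X]addr0; apply: cvgD; first exact: cvg_cst.
rewrite -[X in _ --> X](mulr0 ((gap `^ (p%:R^-1))%:C - 0 : C)).
apply: cvgM; last exact: unitv_weakly_null.
apply: cvgB; last exact: lp_coord_cvg0C.
by apply: cvg_real_complex; exact: radius_cvg.
Qed.

Definition fiber_hom (U : set_system nat) : Au lpT -> C := ueval U approach_pt.

Variable U : set_system nat.
Hypotheses (UU : UltraFilter U) (Uoo : \oo `<=` U).

Lemma fiber_hom_fiber : fiber z (fiber_hom U).
Proof.
split; first exact: ueval_spectrum.
move=> l lc; apply: ueval_lim => A lzA; apply: Uoo.
exact: approach_weak lc A lzA.
Qed.

Section value.
Variables (b : nat -> R[i]) (b1 : forall k, normc (b k) <= 1).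

(** Only the [n]-th term of the series changes. *)
Lemma diagpoly_approach n : diagpoly b (approach n) =
  diagpoly b z + b n * ((radius n ^+ p)%:C - z n ^+ p).
Proof.
apply/eqP; rewrite addrC -subr_eq diagpolyB//; apply/eqP.
have := lim_series_single n (fun k => b k * ((radius n ^+ p)%:C - z k ^+ p)).
move=> <-; congr (limn (series _)); apply/funext => k; rewrite approachE.
by case: eqP => _; rewrite ?subrr ?mulr0// rmorphXn.
Qed.

(** The [n]-th term of [P_b z] is lost, but it tends to [0], whereas the new one
    tends to [a * gap]. *)
Lemma fiber_hom_diag (a : R[i]) : (\forall n \near U, b n = a) ->
  fiber_hom U (diag_Au p1 b1) = diagpoly b z + a * gap%:C.
Proof.
move=> ba; apply: ueval_lim.
have cU (f : nat -> C) (c : C) : f n @[n --> \oo] --> c -> f n @[n --> U] --> c.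
  by move=> fc A cA; apply: Uoo; exact: fc.
have E : \forall n \near U, diag_Au p1 b1 (approach_pt n) =
    diagpoly b z + a * ((radius n ^+ p)%:C - z n ^+ p).
  by apply: filterS ba => n <-; rewrite -diagpoly_approach.
apply: cvg_trans; first exact: near_eq_cvg (filterS (fun n => @esym _ _ _) E).
apply: cU; apply: cvgD; first exact: cvg_cst.
rewrite -[gap%:C]subr0; apply: cvgMl_tmp; apply: cvgB.
  by apply: cvg_real_complex; exact: radiusX_cvg.
have z0p : (0 : C) ^+ p = 0 by rewrite expr0n gtn_eqF// ltnW.
by rewrite -[X in _ --> X]z0p; apply: cvgc_exprn; exact: lp_coord_cvg0C.
Qed.

End value.
End approach_points.

(** * Functions separating the homomorphisms *)

Section separating_function.
Context {R : realType} {p : nat} (p2 : (2 <= p)%N).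
Local Notation C := (R[i])^o.
Local Notation p1 := (ltnW p2).
Local Notation lpT := (lp R p1).
Variable z : lpT.
Hypothesis z1 : unit_ball z.
Variable N : nat.

Definition head_mass : R := \sum_(0 <= k < N) normc (z k) ^+ p.

Lemma head_mass_lt1 : head_mass < 1.
Proof.
apply: (le_lt_trans (lp_partial_sum z N)); rewrite -subr_gt0.
exact: gap_gt0.
Qed.

Lemma head_mass_ge0 : 0 <= head_mass.
Proof. by apply: sumr_ge0 => k _; rewrite exprn_ge0// normc_ge0. Qed.

Definition support_coef k : R[i] := (z k)^* * (normc (z k) ^+ p.-2)%:C.

(** The functional [L]: up to a factor, the one at which Hoelder's inequality is
    an equality for the first [N] coordinates of [z]. *)
Definition support_fun (x : lpT) : C := \sum_(0 <= k < N) support_coef k * x k.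

Lemma normc_support_coef k : normc (support_coef k) = normc (z k) ^+ p.-1.
Proof.
rewrite normcM normc_conj normc_real ger0_norm ?exprn_ge0 ?normc_ge0//.
by rewrite -exprS; congr (_ ^+ _); lia.
Qed.

Lemma support_fun_linear : linear support_fun.
Proof.
move=> a x y; rewrite /support_fun scaler_sumr -big_split/=; apply: eq_bigr => k _.
rewrite -[LHS]/(support_coef k * (a * x k + y k)).
rewrite -[RHS]/(a * (support_coef k * x k) + support_coef k * y k).
ring.
Qed.

HB.instance Definition _ := GRing.isLinear.Build _ _ _ _ support_fun support_fun_linear.

Lemma support_fun_le (x : lpT) : normc (support_fun x) <=
  \sum_(0 <= k < N) normc (z k) ^+ p.-1 * normc (x k).
Proof.
apply: (le_trans (normc_sum _ _ _)); apply: ler_sum => k _.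
by rewrite normcM normc_support_coef.
Qed.

Lemma support_fun_continuous : continuous support_fun.
Proof.
pose M : R := \sum_(0 <= k < N) normc (z k) ^+ p.-1.
have M0 : 0 <= M by apply: sumr_ge0 => k _; rewrite exprn_ge0// normc_ge0.
apply/linear_bounded_continuous/linear_boundedP; near=> r => x.
rewrite [leLHS](_ : _ = (normc (support_fun x))%:C)//.
apply: (@le_trans _ _ (M%:C * `|x|)).
  rewrite lp_normr_lpn -rmorphM lecR (le_trans (support_fun_le x))// mulr_suml.
  by apply: ler_sum => k _; rewrite ler_wpM2l ?exprn_ge0 ?normc_ge0// lp_coord_le.
rewrite ler_wpM2r//; near: r; apply: nbhs_pinfty_ge.
by rewrite ger0_real// ler0c.
Unshelve. all: by end_near. Qed.

Lemma support_fun_self : support_fun z = head_mass%:C.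
Proof.
rewrite rmorph_sum/=; apply: eq_bigr => k _.
rewrite /support_coef mulrAC [(z k)^* * _]mulrC -sqr_normc.
rewrite -[`|z k|]/((normc (z k))%:C) -rmorphXn -rmorphM -exprD.
by congr ((_ ^+ _)%:C); rewrite -subn2 addnC subnK.
Qed.

(** The tangent line inequality in each coordinate, taken at [|z_k|].  It bounds
    the values of [L] by the [p]-th powers of the coordinates of [x], without
    Hoelder's inequality. *)
Lemma support_fun_tangent (x : lpT) :
  p%:R * (\sum_(0 <= k < N) normc (z k) ^+ p.-1 * normc (x k) - head_mass) <=
  \sum_(0 <= k < N) normc (x k) ^+ p - head_mass.
Proof.
rewrite /head_mass -!sumrB mulr_sumr; apply: ler_sum => k _.
have := @power_tangent R p.-1 _ _ (normc_ge0 (z k)) (normc_ge0 (x k)).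
rewrite prednK ?(ltnW p2)//; apply: le_trans; rewrite -mulrA [in leRHS]mulrBr.
by rewrite -exprSr prednK// ltnW.
Qed.

(** Large enough for the constant term of [tilt], [1 - tilt_slope * head_mass],
    to be nonnegative. *)
Definition tilt_power : nat := (Num.truncn (p%:R * head_mass / (1 - head_mass))).+1.

(** The slope for which [tilt ^+ tilt_power / (1 - head_mass)] agrees in
    modulus to first order at [z] with [1 / (1 - \sum_(k < N) |x_k| ^ p)], the largest factor
    that [P_b] can bear on the ball. *)
Definition tilt_slope : R := p%:R / ((1 - head_mass) * tilt_power%:R).

Lemma one_minus_head_gt0 : 0 < 1 - head_mass.
Proof. by rewrite subr_gt0 head_mass_lt1. Qed.

Lemma tilt_slope_head : tilt_slope * head_mass <= 1.
Proof.
have h0 := one_minus_head_gt0.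
rewrite /tilt_slope mulrAC ler_pdivrMr ?mulr_gt0// mul1r.
rewrite [leRHS]mulrC -ler_pdivrMr//.
have q0 : 0 <= p%:R * head_mass / (1 - head_mass).
  by rewrite divr_ge0 ?(ltW h0)// mulr_ge0 ?head_mass_ge0.
by have /andP[_ /ltW] := truncn_itv q0.
Qed.

Definition tilt : Au lpT :=
  1 + tilt_slope%:C *: (dual_Au support_fun_continuous - head_mass%:C *: 1).

Lemma normc_tilt (x : @unit_ball R lpT) : normc (tilt x) <=
  1 + tilt_slope * (\sum_(0 <= k < N) normc (z k) ^+ p.-1 * normc (val x k) - head_mass).
Proof.
have c0 : 0 <= tilt_slope.
  by rewrite divr_ge0// mulr_ge0// ltW// one_minus_head_gt0.
have -> : tilt x = (1 - tilt_slope * head_mass)%:C + tilt_slope%:C * support_fun (val x).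
  rewrite [LHS](_ : _ = 1 + tilt_slope%:C * (support_fun (val x) - head_mass%:C * 1))//.
  move: (support_fun (val x) : R[i]) => w.
  by rewrite rmorphB (rmorphM _ tilt_slope) rmorph1 /=; ring.
apply: (le_trans (le_normcD _ _)); rewrite normcM !normc_real.
rewrite ger0_norm ?subr_ge0 ?tilt_slope_head// (ger0_norm c0) mulrBr.
by rewrite addrA addrAC lerD2l ler_wpM2l// support_fun_le.
Qed.

Section tail.
Variables (b : nat -> R[i]) (b1 : forall k, normc (b k) <= 1).
Hypothesis b0 : forall k, (k < N)%N -> b k = 0.

Definition separator : Au lpT :=
  (1 - head_mass)^-1%:C *: (tilt ^+ tilt_power * diag_Au p1 b1).

(** As [b] vanishes below [N], [P_b] sees only the coordinates from [N] on, and
    the head takes its share of the unit mass. *)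
Lemma normc_tail (x : lpT) : lpn x <= 1 ->
  normc (diagpoly b x) <= 1 - \sum_(0 <= k < N) normc (x k) ^+ p.
Proof.
move=> x1; apply: lim_series_normc => m.
rewrite lerBrDr.
apply: (@le_trans _ _ (\sum_(0 <= k < N + m) normc (x k) ^+ p)); last first.
  by rewrite (le_trans (lp_partial_sum _ _))// exprn_ile1// lpn_ge0.
apply: (@le_trans _ _ (\sum_(0 <= k < N + m) normc (b k * x k ^+ p) +
    \sum_(0 <= k < N) normc (x k) ^+ p)).
  rewrite lerD2r [in leRHS]addnC (big_cat_nat (leq0n m) (leq_addr N m))/= lerDl.
  by apply: sumr_ge0 => k _; exact: normc_ge0.
rewrite !(big_cat_nat (leq0n N) (leq_addr m N))/= big_nat big1 ?add0r; last first.
  by move=> k /andP[_ kN]; rewrite b0// mul0r normc0.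
rewrite [leLHS]addrC lerD2l; apply: ler_sum => k _.
by apply: normc_diag_le => //; rewrite normcX.
Qed.

(** With [u] bounding [|tilt x|] and [v = (1 - s) / (1 - head_mass)] bounding the
    other factor, the condition [m * u + v <= m + 1] of [prod_le1_of_mean] is
    [support_fun_tangent] divided by [1 - head_mass]. *)
Lemma sup_norm_separator : (sup_norm separator <= 1)%E.
Proof.
apply: ge_ereal_sup => _ [x _ <-]; rewrite lee_fin.
have h0 := one_minus_head_gt0.
have /ltW x1 : lpn (val x) < 1 by rewrite -unit_ball_lpn; exact: set_valP.
have -> : separator x = (1 - head_mass)^-1%:C *
    (tilt x ^+ tilt_power * diagpoly b (val x)).
  by rewrite -Au_valX.
set s := \sum_(0 <= k < N) normc (val x k) ^+ p.
set u := 1 + tilt_slope *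
  (\sum_(0 <= k < N) normc (z k) ^+ p.-1 * normc (val x k) - head_mass).
have tu : normc (tilt x) <= u := normc_tilt x.
have ps : normc (diagpoly b (val x)) <= 1 - s := normc_tail x1.
rewrite !normcM normcX normc_real ger0_norm ?invr_ge0 ?(ltW h0)//.
apply: (@le_trans _ _ (u ^+ tilt_power * ((1 - s) / (1 - head_mass)))).
  rewrite mulrC mulrA ler_wpM2r ?invr_ge0 ?(ltW h0)//.
  rewrite ler_pM ?exprn_ge0 ?normc_ge0// lerXn2r ?nnegrE ?normc_ge0//.
  exact: le_trans (normc_ge0 _) tu.
have u0 : 0 <= u := le_trans (normc_ge0 _) tu.
have s0 : 0 <= 1 - s := le_trans (normc_ge0 _) ps.
apply: prod_le1_of_mean => //; first by rewrite divr_ge0// ltW.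
have := support_fun_tangent (val x); rewrite -/s => st.
rewrite /u; set l := \sum_(0 <= k < N) _ in st *.
rewrite mulrDr mulr1 -natr1 -addrA lerD2l.
have -> : tilt_power%:R * (tilt_slope * (l - head_mass)) =
    p%:R * (l - head_mass) / (1 - head_mass).
  rewrite /tilt_slope; field.
  by rewrite gt_eqF// pnatr_eq0.
rewrite -mulrDl ler_pdivrMr// mul1r.
lra.
Qed.

End tail.

End separating_function.

(** * Distance between the homomorphisms *)

Section gleason_separation.
Context {R : realType} {p : nat} (p2 : (2 <= p)%N).
Local Notation C := (R[i])^o.
Local Notation p1 := (ltnW p2).
Local Notation lpT := (lp R p1).
Variable z : lpT.
Hypothesis z1 : unit_ball z.

(** On the fiber, [L] takes the value [L z = head_mass], so that [tilt] takes
    the value [1]. *)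
Lemma fiber_separator N b (b1 : forall k, normc (b k) <= 1) (phi : Au lpT -> C) :
  fiber z phi -> phi (separator z N b1) =
  (1 - head_mass z N)^-1%:C * phi (diag_Au p1 b1).
Proof.
move=> [phis phiz]; have [_ mor _] := phis.
have -> : phi (separator z N b1) =
    (1 - head_mass z N)^-1%:C * (phi (tilt z N) ^+ tilt_power z N * phi (diag_Au p1 b1)).
  by rewrite spectrumZ// mor spectrumX.
suff -> : phi (tilt z N) = 1 by rewrite expr1n mul1r.
rewrite spectrumD// spectrum1// spectrumZ// spectrumB// spectrumZ//.
by rewrite phiz spectrum1// [X in X - _]support_fun_self mulr1 subrr mulr0 addr0.
Qed.

Definition signs N (r : R) k : R[i] :=
  if (k < N)%N then 0 else if indep r k then 1 else -1.

Lemma signs_le1 N r k : normc (signs N r k) <= 1.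
Proof.
rewrite /signs; case: ifP => _; first by rewrite normc0.
by case: ifP => _; rewrite ?normcN normc1.
Qed.

Definition ultra_hom (X : set R) : Au lpT -> C := fiber_hom z1 (ultra X).

Lemma ultra_hom_fiber X : fiber z (ultra_hom X).
Proof. by have [UU Uoo _] := ultraP X; exact: fiber_hom_fiber. Qed.

Lemma ultra_hom_diag X N r : ultra_hom X (diag_Au p1 (signs_le1 N r)) =
  diagpoly (signs N r) z + (if r \in X then 1 else -1) * (gap z)%:C.
Proof.
have [UU Uoo Ur] := ultraP X; apply: fiber_hom_diag => //.
have UN : \forall n \near ultra X, (N <= n)%N by apply: Uoo; exact: nbhs_infty_ge.
apply: filterS2 UN (Ur r) => n Nn <-.
by rewrite /signs ltnNge Nn.
Qed.

Lemma spectrum_dist_ultra X Y r N : (r \in X) != (r \in Y) ->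
  ((2 * gap z / (1 - head_mass z N))%:E <=
    spectrum_dist (ultra_hom X) (ultra_hom Y))%E.
Proof.
move=> XY; apply: ereal_sup_ubound => /=.
exists (separator z N (signs_le1 N r)).
  by apply: (sup_norm_separator z1) => k kN; rewrite /signs kN.
rewrite !fiber_separator; try exact: ultra_hom_fiber.
rewrite !ultra_hom_diag -mulrBr opprD addrACA subrr add0r -mulrBl !normcM !normc_real.
rewrite !ger0_norm ?invr_ge0 ?(ltW (one_minus_head_gt0 z1 N)) ?(ltW (gap_gt0 z1))//.
congr (_%:E); rewrite mulrC; congr (_ * _ / _).
case: (r \in X) XY; case: (r \in Y) => // _.
  by rewrite opprK -[1 + 1]/(2%:R) normc_nat.
by rewrite -opprD normcN -[1 + 1]/(2%:R) normc_nat.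
Qed.

(** As [N] tends to infinity, [1 - head_mass] decreases to [gap]. *)
Lemma spectrum_dist_ultra_ge2 X Y : X <> Y ->
  (2%:E <= spectrum_dist (ultra_hom X) (ultra_hom Y))%E.
Proof.
move=> XY; have [r rXY] : exists r, (r \in X) != (r \in Y).
  apply: contrapT => /forallNP H; apply: XY; apply/seteqP.
  by split => r /mem_set rXY; apply: set_mem; have /negP/negPn/eqP E := H r;
    move: rXY; rewrite E.
set d := spectrum_dist _ _; rewrite leNgt; apply/negP => d2.
have dN N : ((2 * gap z / (1 - head_mass z N))%:E <= d)%E.
  exact: (spectrum_dist_ultra N rXY).
case: d d2 dN => [d||]; last 2 first.
- by rewrite ltNge leey.
- by move=> _ /(_ 0%N); rewrite leeNy_eq.
rewrite lte_fin => d2 dN.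
have fN : 2 * gap z / (1 - head_mass z N) @[N --> \oo] --> (2 : R).
  have g0 : gap z != 0 by rewrite gt_eqF// gap_gt0.
  rewrite -[X in _ --> X](@mulfK _ (gap z))//; apply: cvgMl_tmp; apply: cvgV => //.
  by apply: cvgB; [exact: cvg_cst|exact: lpnX_cvg].
have : 2 <= d.
  rewrite -(cvg_lim (@Rhausdorff R) fN); apply: limr_le.
    by apply/cvg_ex; exists 2.
  by apply: nearW => N; have := dN N; rewrite lee_fin.
by rewrite leNgt d2.
Qed.

End gleason_separation.

Theorem proposition3p5 (R : realType) (p : nat) (hp : (2 <= p)%N)
    (z : lp R (ltnW hp)) :
  unit_ball z ->
  exists S : set (Au (lp R (ltnW hp)) -> (R[i]%C)^o),
    [/\ S `<=` fiber z,
        (S #= [set: set R])%card &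
        forall phi psi, S phi -> S psi -> phi <> psi ->
          gleason_part phi <> gleason_part psi].
Proof.
move=> z1.
have dist2 X Y : X <> Y ->
    ~ (spectrum_dist (ultra_hom z1 X) (ultra_hom z1 Y) < 2%:E)%E.
  by move=> XY; rewrite ltNge spectrum_dist_ultra_ge2.
have dist0 (phi : Au (lp R (ltnW hp)) -> (R[i]%C)^o) :
    (spectrum_dist phi phi < 2%:E)%E.
  apply: (@le_lt_trans _ _ 0%E); last by rewrite lte_fin.
  by apply: ge_ereal_sup => _ [f _ <-]; rewrite subrr normc0.
exists (range (ultra_hom z1)); split.
- by move=> _ [X _ <-]; exact: ultra_hom_fiber.
- apply: inj_card_eq => X Y _ _ XY; apply: contrapT => /dist2; apply.
  by rewrite XY.
- move=> _ _ [X _ <-] [Y _ <-] XY GP.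
  (* each homomorphism lies in its own part: if the parts were equal, the second
     one would be at distance less than 2 from the first *)
  have : gleason_part (ultra_hom z1 Y) (ultra_hom z1 Y).
    by split; [have [] := ultra_hom_fiber z1 Y|exact: dist0].
  rewrite -GP => -[_]; apply: dist2 => XYE; apply: XY.
  by rewrite XYE.
Qed.
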